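(* Let $m\ge1$, $n\ge1$ be integers of the same parity with $(m,n)\ne(1,1)$, and let $f>2$ be an integer. Then \begin{align*} \frac{2}{\phi(f)}\sum_{\chi(-1)=(-1)^m}L(m,\chi)\overline{L(n,\chi)} =\zeta(m+n)\Biggl(&\phi_{m+n}(f)+(-1)^{m-1}\binom{m+n}{m}\sum_{k=1}^{\lfloor m/2\rfloor}\frac{n}{m+n-2k}\binom{m}{2k}\frac{B_{2k}B_{m+n-2k}}{B_{m+n}}\frac{\phi_{2k}(f)}{f^{m+n-2k}}\\ &+(-1)^{n-1}\binom{m+n}{n}\sum_{k=1}^{\lfloor n/2\rfloor}\frac{m}{m+n-2k}\binom{n}{2k}\frac{B_{2k}B_{m+n-2k}}{B_{m+n}}\frac{\phi_{2k}(f)}{f^{m+n-2k}}\Biggr), \end{align*} where $\chi$ ranges over the Dirichlet characters modulo $f$ with $\chi(-1)=(-1)^m=(-1)^n$. In particular, this mean value is asymptotic to $\zeta(m+n)\phi_{m+n}(f)$ as $f\to\infty$.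
   Context: $\phi$ is Euler's totient function, $\zeta$ the Riemann zeta function, $L(m,\chi)$ the Dirichlet $L$-function. $\phi_l(f)=\prod_{p\mid f}(1-1/p^l)$ over primes $p\mid f$. The Bernoulli numbers $B_k$ are defined by $\frac{t}{e^t-1}=\sum_{k\ge0}\frac{B_k}{k!}t^k$. *)

(* Defs.v *)
From HB Require Import structures.
From mathcomp Require Import all_boot all_order all_algebra.
From mathcomp Require Import all_classical all_reals all_analysis.
From mathcomp Require Import complex.

Set Implicit Arguments.
Unset Strict Implicit.
Unset Printing Implicit Defensive.

Import Order.TTheory GRing.Theory Num.Theory.
Import numFieldNormedType.Exports.

Local Open Scope classical_set_scope.
Local Open Scope ring_scope.
Local Open Scope complex_scope.

(* The identity is required on a punctured neighbourhood of 0, because in Rocq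
   t / (expR t - 1) takes the junk value 0 at t = 0.  It determines B. *)
Definition is_bernoulli (R : realType) (B : nat -> R) : Prop :=
  \forall t \near (0 : R)^',
    series (fun k => B k / k`!%:R * t ^+ k) @ \oo --> t / (expR t - 1).

Definition phi_ (R : realType) (l f : nat) : R :=
  \prod_(p <- primes f) (1 - (p%:R ^+ l)^-1).

(* Riemann zeta at an integer s >= 2, where its Dirichlet series converges. *)
Definition zeta (R : realType) (s : nat) : R :=
  limn (fun N => \sum_(1 <= k < N) (k%:R ^+ s)^-1 : R).

(* Dirichlet characters modulo f, for f >= 2 (the ring 'Z_f is Z/2Z when
   f <= 1): homomorphisms (Z/fZ)^* -> C^* extended by 0 to Z/fZ. *)
Definition is_dirichlet_character (R : realType) (f : nat)
    (chi : {ffun 'Z_f -> R[i]}) : Prop :=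
  [/\ chi 1 = 1,
      {morph chi : a b / a * b}
    & forall a, (chi a != 0) = (a \is a GRing.unit)].

(* R[i]^o carries the topology of the modulus.  The sum is the limit of the
   partial sums in order of increasing k: convergence is only conditional for
   m = 1 and chi nonprincipal. *)
Definition dirichlet_L (R : realType) (f m : nat)
    (chi : {ffun 'Z_f -> R[i]}) : R[i] :=
  limn ((fun N => \sum_(1 <= k < N) chi k%:R / k%:R ^+ m) : nat -> R[i]^o).

Definition characters_of_parity (R : realType) (f m : nat) :
    set {ffun 'Z_f -> R[i]} :=
  [set chi | is_dirichlet_character chi /\ chi (-1) = (-1) ^+ m].

Definition mean_value (R : realType) (m n f : nat) : R[i] :=
  2 / (totient f)%:R *
  \sum_(chi \in @characters_of_parity R f m)
     dirichlet_L m chi * (dirichlet_L n chi)^*.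

(* Main.v *)
(* Averaging over characters: orthogonality turns the mean value into
   (1/2) f^-(m+n) sum_a c_m(a/f) c_n(a/f) over residues a prime to f, where
   c_j(x) is the symmetric sum of (i + x)^-j over all integers i (cotfun).
   Splitting 1 / (u^m v^n) into partial fractions in the poles u = i + x and
   v = l + x expresses c_m c_n as c_(m+n) plus a combination of products
   zeta(e) c_j, and the sum of c_j(a/f) over the residues a prime to f is
   f^j (1 + (-1)^j) zeta(j) phi_j(f).
   Euler's formula for zeta(2k) is only needed up to a factor c^k, which cancels
   in zeta(2k) zeta(2r-2k) / zeta(2r): the case m = 1, x = 1/2 of the product
   formula gives (4^r - 1) zeta(2r) = 2 sum_(0<k<r) (4^k - 1) zeta(2k) zeta(2r-2k),
   and the functional equation (h(2t) - h(t)) h(t) = t^2/4 of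
   h(t) = (t/2) coth(t/2) gives the same recursion for B_(2k)/(2k)!. *)
Require Import Defs.
From mathcomp Require Import all_boot all_order all_algebra.
From mathcomp Require Import fingroup cyclic separable cyclotomic mxrepresentation.
From mathcomp Require Import all_classical all_reals all_analysis.
From mathcomp Require Import complex.
From mathcomp Require Import ring lra zify.

Set Implicit Arguments.
Unset Strict Implicit.
Unset Printing Implicit Defensive.

Import Order.TTheory GRing.Theory Num.Theory.
Import numFieldNormedType.Exports.

Local Open Scope classical_set_scope.
Local Open Scope ring_scope.
Local Open Scope complex_scope.

(** * Products of symmetric pole sums *)

(** Exponent 1 shapes the analysis: for m = 1 or n = 1 the double series over the two poles does not
    converge absolutely and cannot be rearranged. Everything is therefore done on the square window
    -M <= i, l < M, where the partial fraction expansion is an exact finite identity. The price is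
    that for a pole near the edge the inner sum over the other pole is lopsided and far from its
    limit. Such poles carry a small weight, and the total error is a harmonic convolution of size
    (log M) / M as soon as m + n > 2. For m = n = 1 the error persists: c_1^2 = c_2 - pi^2, where
    the product formula would give c_2. This is where (m, n) = (1, 1) drops out. The recursions for
    zeta and Bernoulli values match because both carry the weights 4^k - 1: on one side from
    c_j(1/2) = (2^j - 1) [zeta2] j, on the other from comparing h(2t) with h(t). Each recursion
    determines its sequence from the first term, so no trigonometric function and no value of pi
    enters. *)

Definition zsum (R : realType) (e N : nat) : R :=
  \sum_(s < N) (s.+1%:R ^+ e)^-1.

(* The sum of (i + x)^-j over -M <= i < M: with this range x |-> 1 - x is an
   exact symmetry, and a full period of k = a + f i is covered at x = a / f. *)
Definition cotsum (R : realType) (j M : nat) (x : R) : R :=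
  \sum_(i < M + M) ((i%:R - M%:R + x) ^+ j)^-1.

Definition cotfun (R : realType) (j : nat) (x : R) : R :=
  limn (fun M => cotsum j M x).

(* The sum of h^-e over nonzero integers h: zero for e odd. *)
Definition zeta2 (R : realType) (e : nat) : R := (1 + (-1) ^+ e) * zeta R e.

(* The truncation of .-1 at n = i = 0 gives the intended value 1, and
   pfc 0 i = 0 for i > 0, so that the recursion pfcS starts at n = 0. *)
Definition pfc (n i : nat) : nat := 'C((n + i).-1, i).

Lemma pfcS (n i : nat) : pfc n.+1 i.+1 = (pfc n i.+1 + pfc n.+1 i)%N.
Proof.
by rewrite /pfc !addSn !addnS /= binS addnC.
Qed.

(* The polar part at u = 0 of 1 / (u^m v^n), the difference v - u being fixed. *)
Definition pfrac (F : fieldType) (m n : nat) (u v : F) : F :=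
  \sum_(i < m) (-1) ^+ i * (pfc n i)%:R *
     ((v - u) ^+ (n + i))^-1 * (u ^+ (m - i))^-1.

(** From 1 / (u v) = (1/u - 1/v) / (v - u), the function 1 / (u^(m+1) v^(n+1)) satisfies this
    recursion, and taking the polar part at u = 0 commutes with the constant v - u. On coefficients
    it is Pascal's rule [pfcS]. *)
Lemma pfracS (F : fieldType) (m n : nat) (u v : F) : u != v ->
  pfrac m.+1 n.+1 u v = (v - u)^-1 * (pfrac m.+1 n u v - pfrac m n.+1 u v).
Proof.
move=> uv; rewrite /pfrac.
rewrite big_ord_recl [X in _ * (X - _)]big_ord_recl /=.
rewrite mulrBr mulrDr -addrA; congr (_ + _).
  rewrite /pfc !bin0 !addn0 !expr0 !subn0 !mul1r exprS invfM; ring.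
rewrite !big_distrr /= -sumrB; apply: eq_bigr => i _.
rewrite /bump /= !add1n pfcS natrD subSS !addSn addnS (exprS (v - u)) invfM exprS.
have -> : (v - u)^-1 * ((-1) ^+ i * (pfc n.+1 i)%:R / (v - u) ^+ (n + i).+1 / u ^+ (m - i))
  = (v - u)^-1 * ((v - u) ^+ (n + i).+1)^-1 * ((-1) ^+ i * (pfc n.+1 i)%:R / u ^+ (m - i)) by ring.
rewrite /pfc; ring.
Qed.

Lemma pfrac0r (F : fieldType) (m : nat) (u v : F) :
  pfrac m.+1 0 u v = (u ^+ m.+1)^-1.
Proof.
rewrite /pfrac big_ord_recl big1 => [|i _].
  by rewrite /pfc /= bin0 expr0 !mul1r invr1 mul1r subn0 addr0.
by rewrite /pfc /= bin_small ?mulr0 ?mul0r // /bump; lia.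
Qed.

Lemma pfrac0l (F : fieldType) (n : nat) (u v : F) : pfrac 0 n u v = 0.
Proof. by rewrite /pfrac big_ord0. Qed.

(** When one exponent is 0, one polar part is the whole function and the other is empty; [pfracS],
    applied at both poles, carries the induction on m + n. *)
Lemma partial_fractions (F : fieldType) (m n : nat) (u v : F) :
  u != 0 -> v != 0 -> u != v -> (0 < m + n)%N ->
  (u ^+ m)^-1 * (v ^+ n)^-1 = pfrac m n u v + pfrac n m v u.
Proof.
move=> u0 v0 uv; have [k] := ubnP (m + n); elim: k m n => // k IH [|m] [|n] //.
- by move=> _ _; rewrite pfrac0r pfrac0l expr0 invr1 mul1r add0r.
- by move=> _ _; rewrite pfrac0r pfrac0l expr0 invr1 mulr1 addr0.
move=> mnk _; rewrite !pfracS 1?[v == u]eq_sym//.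
have vu0 : v - u != 0 by rewrite subr_eq0 eq_sym.
have H1 : (u ^+ m)^-1 * (v ^+ n.+1)^-1 = pfrac m n.+1 u v + pfrac n.+1 m v u.
  by apply: IH; lia.
have H2 : (u ^+ m.+1)^-1 * (v ^+ n)^-1 = pfrac m.+1 n u v + pfrac n m.+1 v u.
  by apply: IH; lia.
have -> : (u ^+ m.+1)^-1 * (v ^+ n.+1)^-1 =
    (v - u)^-1 * ((u ^+ m.+1)^-1 * (v ^+ n)^-1 - (u ^+ m)^-1 * (v ^+ n.+1)^-1).
  rewrite !exprS; field.
  by rewrite vu0 v0 u0 !expf_neq0.
rewrite H1 H2 -(opprB v u) invrN; ring.
Qed.

Lemma zsum_addn (R : realType) (e N k : nat) :
  zsum R e (N + k) = zsum R e N + \sum_(s < k) ((N + s).+1%:R ^+ e)^-1.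
Proof. by rewrite /zsum big_split_ord. Qed.

(** Telescoping, with a = s + 1: 1/a^e <= 1/a^2 <= 2 / (a (a + 1)) = 2/a - 2/(a + 1). *)
Lemma zsum_tail (R : realType) (e N k : nat) : (1 < e)%N ->
  0 <= zsum R e (N + k) - zsum R e N <= 2 / N.+1%:R.
Proof.
move=> e1; rewrite zsum_addn addrAC subrr add0r; apply/andP; split.
  by apply: sumr_ge0 => i _; rewrite invr_ge0 exprn_ge0.
apply: (@le_trans _ _ (2 / N.+1%:R - 2 / (N + k).+1%:R)); last first.
  by rewrite lerBlDr lerDl divr_ge0.
elim: k => [|k IH]; first by rewrite big_ord0 addn0 subrr.
rewrite big_ord_recr /= -lerBrDr; apply: le_trans IH _.
rewrite lerBrDr -lerBrDl.
have -> : 2 / N.+1%:R - 2 / (N + k.+1).+1%:R - (2 / N.+1%:R - 2 / (N + k).+1%:R)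
  = 2 / ((N + k).+1%:R * (N + k).+2%:R) :> R.
  rewrite addnS -[(N + k).+2]addn1 natrD.
  have p0 : (N + k).+1%:R != 0 :> R by rewrite pnatr_eq0.
  have p1 : (N + k).+1%:R + 1 != 0 :> R by rewrite natr1 pnatr_eq0.
  have p2 : N.+1%:R != 0 :> R by rewrite pnatr_eq0.
  by move: (_%:R) p0 p1 (N.+1%:R) p2 => a p0 p1 b p2; field; apply/and3P.
have e2 : ((N + k).+1%:R ^+ e)^-1 <= ((N + k).+1%:R ^+ 2)^-1 :> R.
  by rewrite lef_pV2 ?posrE ?exprn_gt0// ler_weXn2l// ler1n.
apply: le_trans e2 _.
rewrite -[_ / _]invf_div lef_pV2 ?posrE ?exprn_gt0 ?divr_gt0 ?mulr_gt0//.
rewrite ler_pdivrMr// expr2 -mulrA ler_wpM2l// -natrM ler_nat; lia.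
Qed.

Lemma subseq_cvg (T : topologicalType) (u : nat -> T) (l : T) (h : nat -> nat) :
  (forall n, (n <= h n)%N) -> u @ \oo --> l -> (fun n => u (h n)) @ \oo --> l.
Proof.
move=> hh; apply: cvg_comp => A [N _ NA]; exists N => //= n Nn.
by apply: NA => /=; exact: leq_trans (hh n).
Qed.

Lemma zsum_cvg (R : realType) (e : nat) : (1 < e)%N ->
  zsum R e @ \oo --> zeta R e.
Proof.
move=> e1.
have cz : cvgn (zsum R e).
  apply: nondecreasing_is_cvgn.
    apply/nondecreasing_seqP => n; rewrite -addn1.
    by have /andP[+ _] := @zsum_tail R e n 1 e1; rewrite subr_ge0.
  exists 2 => _ [n _ <-].
  have /andP[_] := @zsum_tail R e 0 n e1.
  by rewrite add0n /zsum big_ord0 subr0 divr1.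
suff -> : zeta R e = limn (zsum R e) by [].
rewrite /zeta; apply/cvg_lim => //.
rewrite -cvg_shiftS /=.
by under eq_fun do rewrite big_add1 /= big_mkord.
Qed.

Lemma zeta_tail (R : realType) (e N : nat) : (1 < e)%N ->
  0 <= zeta R e - zsum R e N <= 2 / N.+1%:R.
Proof.
move=> e1.
have cz : (fun k => zsum R e (N + k) - zsum R e N) @ \oo --> zeta R e - zsum R e N.
  apply: cvgB; last exact: cvg_cst.
  by apply: subseq_cvg (@zsum_cvg R e e1) => n; rewrite leq_addl.
apply/andP; split.
  rewrite -(cvg_lim _ cz) //; apply: limr_ge; first by apply/cvg_ex; eexists; exact: cz.
  by near=> k; have /andP[] := @zsum_tail R e N k e1.
rewrite -(cvg_lim _ cz) //; apply: limr_le; first by apply/cvg_ex; eexists; exact: cz.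
by near=> k; have /andP[] := @zsum_tail R e N k e1.
Unshelve. all: by end_near. Qed.

Lemma zeta_ge1 (R : realType) (e : nat) : (1 < e)%N -> 1 <= zeta R e.
Proof.
move=> e1; have /andP[+ _] := @zeta_tail R e 1 e1.
by rewrite subr_ge0 /zsum big_ord1 expr1n invr1.
Qed.

(** Since 1 / ((s + 1) (M - s)) = (1/(s + 1) + 1/(M - s)) / (M + 1), the sum is 2 / (M + 1) times a
    harmonic sum, at most twice a Cesaro mean of a null sequence. *)
Lemma harmonic_convolution_cvg0 (R : realType) :
  (fun M => \sum_(s < M) (s.+1%:R * (M - s)%:R)^-1 : R) @ \oo --> (0 : R).
Proof.
rewrite -cvg_shiftS /=.
apply: (@squeeze_cvgr _ _ _ _ (cst 0) (fun M => 2 * arithmetic_mean (@harmonic R) M)).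
- near=> M; rewrite sumr_ge0 /=; last by move=> i _; rewrite invr_ge0 mulr_ge0.
  rewrite /arithmetic_mean /series /= big_mkord.
  have -> : \sum_(s < M.+1) (s.+1%:R * (M.+1 - s)%:R)^-1 =
     M.+2%:R^-1 * (\sum_(s < M.+1) s.+1%:R^-1 + \sum_(s < M.+1) (M.+1 - s)%:R^-1) :> R.
    rewrite -big_split big_distrr; apply: eq_bigr => s _ /=.
    have sM := ltn_ord s.
    have -> : M.+2%:R = s.+1%:R + (M.+1 - s)%:R :> R by rewrite -natrD; congr (_%:R); lia.
    have : (M.+1 - s)%:R != 0 :> R by rewrite pnatr_eq0; lia.
    have : s.+1%:R != 0 :> R by rewrite pnatr_eq0.
    have : s.+1%:R + (M.+1 - s)%:R != 0 :> R by rewrite -natrD pnatr_eq0.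
    by move: (s.+1%:R : R) (_%:R : R) => a b ab a0 b0; field; apply/and3P.
  rewrite [X in _ + X](reindex_inj rev_ord_inj) /=.
  under [X in _ + X]eq_bigr => i _.
    have -> : (M.+1 - (M.+1 - i.+1))%N = i.+1 by have := ltn_ord i; lia.
    over.
  rewrite -mulr2n -[_ *+ 2]mulr_natl mulrCA ler_wpM2l// ler_wpM2r//.
    by apply: sumr_ge0.
  by rewrite lef_pV2 ?posrE// ler_nat.
- exact: cvg_cst.
- rewrite -(mulr0 2); apply: cvgM; first exact: cvg_cst.
  exact: cesaro (cvg_harmonic).
Unshelve. all: by end_near. Qed.

Lemma invXN (F : fieldType) (e : nat) (a : F) :
  ((- a) ^+ e)^-1 = (-1) ^+ e * (a ^+ e)^-1.
Proof. by rewrite (exprNn a) invfM -exprVn invrN1. Qed.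

Lemma sum_center (V : zmodType) (M : nat) (F : nat -> V) :
  \sum_(i < M + M) F i = \sum_(s < M) (F (M + s)%N + F (M - s.+1)%N).
Proof.
rewrite big_split_ord big_split /= addrC; congr (_ + _).
by rewrite (reindex_inj rev_ord_inj).
Qed.

Lemma cotsum_fold (R : realType) (j M : nat) (x : R) :
  cotsum j M x =
  \sum_(s < M) (((s%:R + x) ^+ j)^-1 + (-1) ^+ j * ((s%:R + (1 - x)) ^+ j)^-1).
Proof.
rewrite /cotsum (sum_center M (fun i => ((i%:R - M%:R + x) ^+ j)^-1)).
apply: eq_bigr => s _; congr (_ + _).
  by rewrite natrD; congr (_ ^+ _)^-1; ring.
rewrite natrB//.
have -> : M%:R - s.+1%:R - M%:R + x = - (s%:R + (1 - x)) by rewrite -natr1; ring.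
exact: invXN.
Qed.

(** Because y (s + 1) <= s + y for y < 1. This trades shifted poles for integers at the cost of a
    factor independent of s. *)
Lemma pole_weight (R : realType) (j s : nat) (y : R) : 0 < y < 1 ->
  0 <= ((s%:R + y) ^+ j)^-1 <= (y ^+ j)^-1 * (s.+1%:R ^+ j)^-1.
Proof.
move=> /andP[y0 y1]; have sy : 0 < s%:R + y by rewrite ltr_wpDl.
apply/andP; split; first by rewrite invr_ge0 exprn_ge0 ?ltW.
rewrite -invfM -exprMn lef_pV2 ?posrE ?exprn_gt0 ?mulr_gt0//.
apply: lerXn2r; [by rewrite nnegrE mulr_ge0// ltW|by rewrite nnegrE ltW|].
by rewrite -natr1 mulrDr mulr1 lerD2r ler_piMl// ltW.
Qed.

Lemma cotsum_term_bound (R : realType) (j : nat) (x : R) : (0 < j)%N -> 0 < x < 1 ->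
  exists C : R, forall s : nat,
  `|((s%:R + x) ^+ j)^-1 + (-1) ^+ j * ((s%:R + (1 - x)) ^+ j)^-1|
     <= C * (s.+1%:R ^+ 2)^-1.
Proof.
move=> j0 x01; have y01 : 0 < 1 - x < 1 by lra.
case: j j0 => [//|[|j]] _.
  exists (x^-1 * (1 - x)^-1) => s; rewrite !expr1.
  have /andP[a0 a1] := pole_weight 1 s x01.
  have /andP[b0 b1] := pole_weight 1 s y01.
  rewrite !expr1 in a0 a1 b0 b1.
  (* For j = 1 neither term is summable in s, but the paired poles cancel to order s^-2. *)
  have -> : (s%:R + x)^-1 + -1 * (s%:R + (1 - x))^-1
      = (1 - 2 * x) * ((s%:R + x)^-1 * (s%:R + (1 - x))^-1).
    field; have s0 : 0 <= s%:R :> R by [].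
    by apply/andP; split; apply/eqP; lra.
  rewrite normrM [`|_ * _^-1|]ger0_norm ?mulr_ge0//.
  have -> : x^-1 / (1 - x) / s.+1%:R ^+ 2 =
    1 * ((x^-1 / s.+1%:R) * ((1 - x)^-1 / s.+1%:R)) by rewrite expr2 invfM; ring.
  apply: ler_pM => //; first by rewrite mulr_ge0.
    by rewrite ler_norml; lra.
  by apply: ler_pM.
exists ((x ^+ j.+2)^-1 + ((1 - x) ^+ j.+2)^-1) => s.
have /andP[a0 a1] := pole_weight j.+2 s x01.
have /andP[b0 b1] := pole_weight j.+2 s y01.
have e2 : (s.+1%:R ^+ j.+2)^-1 <= (s.+1%:R ^+ 2)^-1 :> R.
  by rewrite lef_pV2 ?posrE ?exprn_gt0// ler_weXn2l// ler1n.
apply: le_trans (ler_normD _ _) _.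
rewrite normrM normrX normrN1 expr1n mul1r !ger0_norm// mulrDl.
have x0 : 0 < x by lra.
have y0 : 0 < 1 - x by lra.
by apply: lerD; [apply: le_trans a1 _|apply: le_trans b1 _];
  rewrite ler_wpM2l// invr_ge0 exprn_ge0 ?ltW.
Qed.

Lemma cotsum_cvg (R : realType) (j : nat) (x : R) : (0 < j)%N -> 0 < x < 1 ->
  (fun M => cotsum j M x) @ \oo --> cotfun j x.
Proof.
move=> j0 x01.
pose t s := ((s%:R + x) ^+ j)^-1 + (-1) ^+ j * ((s%:R + (1 - x)) ^+ j)^-1.
have tE : (fun M => cotsum j M x) = series t.
  by apply/funext => M; rewrite cotsum_fold /series /= big_mkord.
suff : cvgn (series t) by rewrite /cotfun tE.
have [C HC] := cotsum_term_bound j0 x01.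
apply: normed_cvg; apply: (@series_le_cvg _ _ (fun s => C * (s.+1%:R ^+ 2)^-1)) => //.
- by move=> n; exact: normr_ge0.
- by move=> n; exact: le_trans (normr_ge0 _) (HC n).
apply/cvg_ex; exists (C * zeta R 2).
have -> : [series C * (s.+1%:R ^+ 2)^-1]_s = (fun N => C * zsum R 2 N).
  by apply/funext => N; rewrite /series /= big_mkord /zsum big_distrr.
by apply: cvgM; [exact: cvg_cst|exact: zsum_cvg].
Qed.

Lemma cotfunN (R : realType) (j : nat) (x : R) : (0 < j)%N -> 0 < x < 1 ->
  cotfun j (1 - x) = (-1) ^+ j * cotfun j x.
Proof.
move=> j0 x01; have y01 : 0 < 1 - x < 1 by lra.
have cx : (fun M => (-1) ^+ j * cotsum j M x) @ \oo --> (-1) ^+ j * cotfun j x.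
  by apply: cvgM; [exact: cvg_cst|exact: cotsum_cvg].
apply: cvg_lim => //.
suff -> : (fun M => cotsum j M (1 - x)) = (fun M => (-1) ^+ j * cotsum j M x) by [].
apply/funext => M; rewrite !cotsum_fold big_distrr; apply: eq_bigr => s _ /=.
have -> : 1 - (1 - x) = x by ring.
by rewrite mulrDr mulrA -expr2 sqrr_sign mul1r addrC.
Qed.

(** The sum of h^-e over the nonzero differences h = l - k inside a window of K indices: K - k - 1
    of them lie to the right of k and k to its left. It is close to [zeta2] only when k is far from
    both ends. *)
Definition gapsum (R : realType) (e K k : nat) : R :=
  zsum R e (K - k.+1) + (-1) ^+ e * zsum R e k.

Lemma gapsumE (R : realType) (e M : nat) (x : R) (k : 'I_(M + M)) :
  \sum_(l < M + M | l != k) (((l%:R - M%:R + x) - (k%:R - M%:R + x)) ^+ e)^-1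
  = gapsum R e (M + M) k.
Proof.

under eq_bigr => l _.
  have -> : l%:R - M%:R + x - (k%:R - M%:R + x) = l%:R - k%:R by ring.
  over.
move: (M + M)%N k => K k.
have kK := ltn_ord k.
have : forall G : nat -> R, \sum_(l < K | l != k) G l =
   \sum_(s < K - k.+1) G (k.+1 + s)%N + \sum_(s < k) G (k - s.+1)%N.
  move=> G; rewrite -(big_mkord (fun l => l != k :> nat) G).
  rewrite (big_cat_nat (n:=k)) /=; [|by []|exact: ltnW]; rewrite addrC; congr (_ + _).
    rewrite big_ltn_cond// eqxx /= big_nat_cond.
    rewrite (eq_bigl (fun i => (k.+1 <= i < K)%N && true)); last first.
      by move=> i; rewrite andbT; case: ltngtP => //= ki; rewrite andbT.
    rewrite -big_nat_cond -{1}[k.+1]add0n big_addn big_mkord.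
    by apply: eq_bigr => i _; rewrite addnC.
  rewrite big_nat_cond (eq_bigl (fun i => (0 <= i < k)%N && true)); last first.
    by move=> i; rewrite andbT /=; case: ltngtP.
  by rewrite -big_nat_cond big_mkord (reindex_inj rev_ord_inj).
move=> /(_ (fun l => ((l%:R - k%:R) ^+ e)^-1)) ->; rewrite /gapsum /zsum; congr (_ + _).
  apply: eq_bigr => s _; congr ((_ ^+ _)^-1).
  by rewrite -natrB ?leq_addr//; [congr (_%:R); lia|lia].
rewrite big_distrr; apply: eq_bigr => s _ /=.
rewrite natrB//; have -> : k%:R - s.+1%:R - k%:R = - s.+1%:R :> R by ring.
exact: invXN.
Qed.

Lemma zeta_pair_error (R : realType) (e N a b : nat) :
  (1 < e)%N -> (N <= a)%N -> (N <= b)%N ->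
  `|zsum R e a + (-1) ^+ e * zsum R e b - zeta2 R e| <= 4 / N.+1%:R.
Proof.
move=> e1 Na Nb.
have tail c : (N <= c)%N -> `|zeta R e - zsum R e c| <= 2 / N.+1%:R.
  move=> Nc; have /andP[c0 c1] := zeta_tail R c e1.
  rewrite ger0_norm//; apply: le_trans c1 _.
  by rewrite ler_wpM2l// lef_pV2 ?posrE// ler_nat.
have -> : zsum R e a + (-1) ^+ e * zsum R e b - zeta2 R e =
  - (zeta R e - zsum R e a) - (-1) ^+ e * (zeta R e - zsum R e b).
  by rewrite /zeta2; ring.
apply: le_trans (ler_normB _ _) _.
rewrite normrN normrM normrX normrN1 expr1n mul1r.
apply: le_trans (lerD (tail _ Na) (tail _ Nb)) _.
by rewrite -mulrDl -natrD.
Qed.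

Lemma harmonic_block (R : realType) (N k : nat) :
  `|zsum R 1 (N + k) - zsum R 1 N| <= k%:R / N.+1%:R.
Proof.
rewrite zsum_addn addrAC subrr add0r ger0_norm; last first.
  by apply: sumr_ge0 => i _; rewrite invr_ge0 exprn_ge0.
rewrite mulr_natl -[X in _ *+ X]card_ord -sumr_const; apply: ler_sum => i _.
by rewrite expr1 lef_pV2 ?posrE// ler_nat ltnS leq_addr.
Qed.

(** Replacing h by -h multiplies the truncated sum and its limit by the same sign (-1)^e. Hence the
    two indices paired around the centre of the window have errors of equal size. *)
Lemma zeta_pair_swap (R : realType) (e a b : nat) :
  `|zsum R e a + (-1) ^+ e * zsum R e b - zeta2 R e| =
  `|zsum R e b + (-1) ^+ e * zsum R e a - zeta2 R e|.
Proof.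
have -> : zsum R e b + (-1) ^+ e * zsum R e a - zeta2 R e =
  (-1) ^+ e * (zsum R e a + (-1) ^+ e * zsum R e b - zeta2 R e) +
  (1 - (-1) ^+ e * (-1) ^+ e) * (zsum R e b - zeta R e).
  by rewrite /zeta2; ring.
rewrite -expr2 sqrr_sign subrr mul0r addr0.
by rewrite [RHS]normrM normrX normrN1 expr1n mul1r.
Qed.

(** For e >= 2 the zeta tails already give 4 / (M - s). For e = 1 [zeta2] is 0 and the two harmonic
    sums differ by a block of 2 s + 1 terms, each at most 1 / (M - s): this costs a factor s + 1,
    which the weight pays for because then j >= 2. That is the use of [2 < j + e]. *)
Lemma weighted_pair_error (R : realType) (j e M s : nat) :
  (0 < j)%N -> (0 < e)%N -> (2 < j + e)%N -> (s < M)%N ->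
  (s.+1%:R ^+ j)^-1 *
    `|zsum R e (M + s) + (-1) ^+ e * zsum R e (M - s.+1) - zeta2 R e|
  <= 4 * (s.+1%:R * (M - s)%:R)^-1.
Proof.
move=> j0 e0 je sM.
have Ms : (M - s.+1).+1 = (M - s)%N by lia.
have powle i : (i <= j)%N -> (s.+1%:R ^+ j)^-1 <= (s.+1%:R ^+ i)^-1 :> R.
  by move=> ij; rewrite lef_pV2 ?posrE ?exprn_gt0// ler_weXn2l// ler1n.
have [e1|e1] := ltnP 1 e.
  have := @zeta_pair_error R e (M - s.+1) (M + s) (M - s.+1) e1.
  rewrite leqnn Ms => /(_ ltac:(lia) isT) H.
  have -> : 4 * (s.+1%:R * (M - s)%:R)^-1 = (s.+1%:R ^+ 1)^-1 * (4 / (M - s)%:R) :> R.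
    by rewrite expr1 invfM; ring.
  by apply: ler_pM; rewrite ?invr_ge0 ?exprn_ge0// powle.
have -> : e = 1%N by lia.
rewrite expr1 mulN1r /zeta2 expr1 subrr mul0r subr0.
have -> : (M + s = M - s.+1 + (2 * s).+1)%N by lia.
have H := harmonic_block R (M - s.+1) (2 * s).+1.
rewrite Ms in H.
have -> : 4 * (s.+1%:R * (M - s)%:R)^-1 =
  (s.+1%:R ^+ 2)^-1 * ((4 * s.+1%:R) / (M - s)%:R) :> R.
  have : s.+1%:R != 0 :> R by rewrite pnatr_eq0.
  have : (M - s)%:R != 0 :> R by rewrite pnatr_eq0; lia.
  by move: (s.+1%:R : R) ((M - s)%:R : R) => a b b0 a0; field; apply/andP.
apply: ler_pM; rewrite ?invr_ge0 ?exprn_ge0//.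
  by apply: powle; lia.
apply: le_trans H _; rewrite ler_wpM2r ?invr_ge0// -natrM ler_nat; lia.
Qed.

Definition cot_defect (R : realType) (j e M : nat) (x : R) : R :=
  \sum_(k < M + M) ((k%:R - M%:R + x) ^+ j)^-1 * (gapsum R e (M + M) k - zeta2 R e).

(** The errors of the inner sums are not uniformly small: at the edges of the window they do not
    vanish as M grows. There the weight of the pole is small, and pairing the poles s + x and -(s +
    1 - x) bounds the whole by a harmonic convolution. *)
Lemma cot_defect_cvg0 (R : realType) (j e : nat) (x : R) :
  (0 < j)%N -> (0 < e)%N -> (2 < j + e)%N -> 0 < x < 1 ->
  (fun M => cot_defect j e M x) @ \oo --> (0 : R).
Proof.
move=> j0 e0 je x01; have y01 : 0 < 1 - x < 1 by lra.
pose C := 4 * ((x ^+ j)^-1 + ((1 - x) ^+ j)^-1).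
pose B M := C * \sum_(s < M) (s.+1%:R * (M - s)%:R)^-1.
have B0 : B @ \oo --> (0 : R).
  rewrite -(mulr0 C); apply: cvgM; first exact: cvg_cst.
  exact: harmonic_convolution_cvg0.
suff bound M : `|cot_defect j e M x| <= B M.
  apply: (@squeeze_cvgr _ _ _ _ (fun M => - B M) B) => //.
    by near=> M; rewrite -ler_norml.
  by rewrite -oppr0; exact: cvgN.
rewrite /cot_defect (sum_center M (fun k =>
   ((k%:R - M%:R + x) ^+ j)^-1 * (gapsum R e (M + M) k - zeta2 R e))).
apply: le_trans (ler_norm_sum _ _ _) _.
rewrite /B big_distrr; apply: ler_sum => s _ /=.
have sM := ltn_ord s.
rewrite /gapsum.
have -> : (M + M - (M + s).+1 = M - s.+1)%N by lia.
have -> : (M + M - (M - s.+1).+1 = M + s)%N by lia.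
have -> : (M + s)%:R - M%:R + x = s%:R + x by rewrite natrD; ring.
have -> : (M - s.+1)%:R - M%:R + x = - (s%:R + (1 - x)).
  by rewrite natrB// -natr1; ring.
rewrite invXN; apply: le_trans (ler_normD _ _) _.
rewrite -mulrA !normrM normrX normrN1 expr1n mul1r (zeta_pair_swap _ _ (M - s.+1)).
rewrite -mulrDl.
have /andP[a0 a1] := pole_weight j s x01.
have /andP[b0 b1] := pole_weight j s y01.
rewrite (ger0_norm a0) (ger0_norm b0).
apply: (@le_trans _ _ (((x ^+ j)^-1 + ((1 - x) ^+ j)^-1) * ((s.+1%:R ^+ j)^-1 *
   `|zsum R e (M + s) + (-1) ^+ e * zsum R e (M - s.+1) - zeta2 R e|))).
  by rewrite [leRHS]mulrA ler_wpM2r// mulrDl lerD.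
rewrite /C [X in _ <= X * _]mulrC -[leRHS]mulrA ler_wpM2l//.
  by rewrite addr_ge0// invr_ge0 exprn_ge0//; lra.
exact: weighted_pair_error.
Unshelve. all: by end_near. Qed.

Lemma pole_neq0 (R : realType) (M k : nat) (x : R) : 0 < x < 1 ->
  k%:R - M%:R + x != 0.
Proof.
move=> x01; apply/eqP => kMx.
have [kM|Mk] := ltnP k M.
  have : k.+1%:R <= M%:R :> R by rewrite ler_nat.
  rewrite -natr1; lra.
have : M%:R <= k%:R :> R by rewrite ler_nat.
lra.
Qed.

Lemma cvgn_sum (K : numFieldType) (V : normedModType K) (I : Type) (r : seq I)
    (P : pred I) (f : I -> nat -> V) (l : I -> V) :
  (forall i, P i -> f i @ \oo --> l i) ->
  (fun n => \sum_(i <- r | P i) f i n) @ \oo --> \sum_(i <- r | P i) l i.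
Proof. by move=> fl; apply: cvg_big => //; exact: add_continuous. Qed.

Definition cot_half (R : realType) (m n M : nat) (x : R) : R :=
  \sum_(i < m) (-1) ^+ i * (pfc n i)%:R *
    (cot_defect (m - i) (n + i) M x + zeta2 R (n + i) * cotsum (m - i) M x).

Lemma cot_halfE (R : realType) (m n M : nat) (x : R) :
  \sum_(k < M + M) \sum_(l < M + M | l != k)
     pfrac m n (k%:R - M%:R + x) (l%:R - M%:R + x) = cot_half m n M x.
Proof.
rewrite /cot_half /pfrac.
under eq_bigr do rewrite exchange_big /=.
rewrite exchange_big /=; apply: eq_bigr => i _.
rewrite /cot_defect /cotsum [zeta2 _ _ * _]big_distrr -big_split big_distrr /=.
apply: eq_bigr => k _.
rewrite -big_distrl -big_distrr /= gapsumE; ring.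
Qed.

(** The diagonal k = l gives [cotsum (m + n)]. Each off-diagonal product splits into two polar
    parts, the second being summed with k and l exchanged so that in both halves the outer index
    carries the pole. *)
Lemma cotsum_mul (R : realType) (m n M : nat) (x : R) :
  (0 < m)%N -> 0 < x < 1 ->
  cotsum m M x * cotsum n M x =
  cotsum (m + n) M x + cot_half m n M x + cot_half n m M x.
Proof.
move=> m0 x01; rewrite -!cot_halfE [X in _ + X](exchange_big_dep xpredT)//=.
rewrite /cotsum big_distrl -!big_split /=; apply: eq_bigr => k _.
rewrite big_distrr (bigD1 k)//= exprD invfM -addrA; congr (_ + _).
rewrite [X in _ = _ + X](eq_bigl (fun l => l != k)) => [|l]; last by rewrite eq_sym.
rewrite -big_split /=; apply: eq_bigr => l lk.
rewrite partial_fractions ?pole_neq0//; last by rewrite addn_gt0 m0.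
rewrite -subr_eq0 opprD addrACA subrr addr0 opprB addrA subrK subr_eq0.
by rewrite eqr_nat eq_sym.
Qed.

Lemma cot_half_cvg (R : realType) (m n : nat) (x : R) :
  (0 < m)%N -> (0 < n)%N -> (2 < m + n)%N -> 0 < x < 1 ->
  (fun M => cot_half m n M x) @ \oo -->
  \sum_(i < m) (-1) ^+ i * (pfc n i)%:R * (zeta2 R (n + i) * cotfun (m - i) x).
Proof.
move=> m0 n0 mn x01; rewrite /cot_half.
apply: cvgn_sum => i _.
apply: cvgM; first exact: cvg_cst.
have im := ltn_ord i.
rewrite -[X in _ --> X]add0r; apply: cvgD.
  by apply: cot_defect_cvg0 => //; lia.
by apply: cvgM; [exact: cvg_cst|apply: cotsum_cvg => //; lia].
Qed.

Theorem cotfun_mul (R : realType) (m n : nat) (x : R) :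
  (0 < m)%N -> (0 < n)%N -> (2 < m + n)%N -> 0 < x < 1 ->
  cotfun m x * cotfun n x = cotfun (m + n) x +
  \sum_(i < m) (-1) ^+ i * (pfc n i)%:R * (zeta2 R (n + i) * cotfun (m - i) x) +
  \sum_(i < n) (-1) ^+ i * (pfc m i)%:R * (zeta2 R (m + i) * cotfun (n - i) x).
Proof.
move=> m0 n0 mn x01.
have : (fun M => cotsum m M x * cotsum n M x) @ \oo --> cotfun m x * cotfun n x.
  by apply: cvgM; exact: cotsum_cvg.
rewrite (_ : (fun M => _) =
    (fun M => cotsum (m + n) M x + cot_half m n M x + cot_half n m M x)); last first.
  by apply/funext => M; exact: cotsum_mul.
move/cvg_lim => <- //; apply: cvg_lim => //.
by apply: cvgD; [apply: cvgD; [apply: cotsum_cvg|]|]; rewrite ?addn_gt0 ?m0//;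
  apply: cot_half_cvg; rewrite // addnC.
Qed.

(** * Sums over residues prime to the modulus *)

Lemma sum_blocks (V : nmodType) (f N : nat) (G : nat -> V) :
  \sum_(k < N * f) G k = \sum_(i < N) \sum_(r < f) G (i * f + r)%N.
Proof.
elim: N => [|N IH]; first by rewrite mul0n !big_ord0.
by rewrite big_ord_recr /= mulSnr big_split_ord /= IH.
Qed.

Definition sieved (R : realType) (j : nat) (ps : seq nat) (N : nat) : R :=
  \sum_(k < N | all (fun p => ~~ (p %| k.+1)%N) ps) (k.+1%:R ^+ j)^-1.

Lemma sieved_is_cvg (R : realType) (j : nat) (ps : seq nat) : (1 < j)%N ->
  cvgn (sieved R j ps).
Proof.
move=> j1; apply: nondecreasing_is_cvgn.
  apply/nondecreasing_seqP => n; rewrite /sieved big_mkcond [leRHS]big_mkcond /=.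
  by rewrite big_ord_recr /= lerDl; case: ifP.
exists (zeta R j) => _ [n _ <-].
apply: (@le_trans _ _ (zsum R j n)); last first.
  by rewrite -subr_ge0; have /andP[] := zeta_tail R n j1.
rewrite /sieved /zsum big_mkcond /=; apply: ler_sum => i _.
by case: ifP => // _; rewrite invr_ge0 exprn_ge0.
Qed.

(** The multiples of p up to N p are p k with k <= N, and the other primes divide p k exactly when
    they divide k. Truncating at N p leaves no remainder. *)
Lemma sieved_cons (R : realType) (j p : nat) (ps : seq nat) (N : nat) :
  prime p -> p \notin ps -> all prime ps ->
  sieved R j (p :: ps) (N * p) =
  sieved R j ps (N * p) - (p%:R ^+ j)^-1 * sieved R j ps N.
Proof.
move=> pp pps psp; apply/eqP; rewrite eq_sym subr_eq; apply/eqP.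
rewrite {1}/sieved (bigID (fun k : 'I__ => ~~ (p %| k.+1)%N)) /=; congr (_ + _).
  by apply: eq_bigl => k; rewrite andbC.
pose G k : R := if all (fun q => ~~ (q %| k.+1)%N) ps && ~~ ~~ (p %| k.+1)%N
  then (k.+1%:R ^+ j)^-1 else 0.
rewrite big_mkcond /= -/(G _) (sum_blocks p N G) /sieved big_distrr /=.
rewrite [RHS]big_mkcond /=; apply: eq_bigr => i _.
have p0 := prime_gt0 pp.
case: p pp pps p0 @G => // p pp pps _ G.
rewrite big_ord_recr /= big1 ?add0r => [|r _]; last first.
  rewrite /G negbK -addnS addnC; case: ifP => // /andP[_].
  by rewrite dvdn_addl ?dvdn_mull// => /(dvdn_leq (ltn0Sn _)); have := ltn_ord r; lia.
rewrite /G negbK; have -> : (i * p.+1 + p).+1 = (p.+1 * i.+1)%N by lia.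
rewrite dvdn_mulr// andbT natrM exprMn invfM.
congr (if _ then _ else _); apply: eq_in_all => q qps.
have q_prime := allP psp _ qps.
rewrite Euclid_dvdM// dvdn_prime2//.
by case: eqP => // qp; rewrite -qp qps in pps.
Qed.

Lemma sieved_cvg (R : realType) (j : nat) (ps : seq nat) : (1 < j)%N ->
  uniq ps -> all prime ps ->
  sieved R j ps @ \oo --> zeta R j * \prod_(p <- ps) (1 - (p%:R ^+ j)^-1).
Proof.
move=> j1; elim: ps => [_ _|p ps IH /= /andP[pps ups] /andP[pp psp]].
  by rewrite big_nil mulr1; exact: zsum_cvg.
have {}IH := IH ups psp.
have c := @sieved_is_cvg R j (p :: ps) j1.
suff <- : limn (sieved R j (p :: ps)) =
    zeta R j * \prod_(q <- p :: ps) (1 - (q%:R ^+ j)^-1) by [].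
have hp N : (N <= N * p)%N by rewrite leq_pmulr// prime_gt0.
(* Monotonicity has already given a limit, so it may be read off along the multiples N p, where
   [sieved_cons] is exact. *)
rewrite -(cvg_lim _ (subseq_cvg hp c))//; apply: cvg_lim => //.
under eq_fun do rewrite sieved_cons//.
rewrite big_cons mulrCA mulrBl mul1r.
apply: cvgB; first exact: subseq_cvg IH.
by apply: cvgM; [exact: cvg_cst|exact: IH].
Qed.

Lemma all_primes_coprime (f k : nat) : (0 < f)%N -> (0 < k)%N ->
  all (fun p => ~~ (p %| k)%N) (primes f) = coprime k f.
Proof.
move=> f0 k0; rewrite coprime_has_primes// -all_predC; apply: eq_in_all => p.
by rewrite mem_primes f0 /= => /andP[pp _]; rewrite mem_primes pp k0.
Qed.

Lemma coprime_zeta_cvg (R : realType) (f j : nat) : (1 < f)%N -> (1 < j)%N ->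
  (fun N => \sum_(k < N | coprime k f) (k%:R ^+ j)^-1 : R) @ \oo -->
  zeta R j * phi_ R j f.
Proof.
move=> f1 j1; rewrite -cvg_shiftS /=.
have -> : (fun N => \sum_(k < N.+1 | coprime k f) (k%:R ^+ j)^-1) =
    sieved R j (primes f).
  apply/funext => N; rewrite big_mkcond big_ord_recl /=.
  have -> : coprime 0 f = false by apply/eqP; rewrite gcd0n; lia.
  rewrite add0r /sieved [RHS]big_mkcond /=; apply: eq_bigr => k _.
  by rewrite all_primes_coprime// ltnW.
apply: sieved_cvg => //; first exact: primes_uniq.
by apply/allP => p; rewrite mem_primes => /and3P[].
Qed.

Lemma frac01 (R : realType) (f a : nat) : (1 < f)%N -> (a < f)%N -> coprime a f ->
  0 < (a%:R / f%:R : R) < 1.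
Proof.
move=> f1 af caf; have a0 : (0 < a)%N.
  by case: a caf {af} => //; rewrite /coprime gcd0n; lia.
by rewrite divr_gt0 ?ltr0n//=; [rewrite ltr_pdivrMr ?mul1r ?ltr_nat// ltr0n|]; lia.
Qed.

Lemma coprime_subl (f a : nat) : (a <= f)%N -> coprime (f - a) f = coprime a f.
Proof.
by move=> af; rewrite -[X in coprime _ X](subnK af) /coprime gcdnDl -{2}(subnK af) gcdnDr gcdnC.
Qed.

(** For even j both halves of [cotsum_fold] have the same sign and a -> f - a exchanges them, whence
    the factor 2. The integers s f + a with s < M and a prime to f are those below M f prime to f;
    the residue 0 is absent since f > 1. *)
Lemma sum_coprime_cotsum (R : realType) (f j M : nat) : (1 < f)%N -> ~~ odd j ->
  \sum_(1 <= a < f | coprime a f) cotsum j M (a%:R / f%:R : R) =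
  2 * f%:R ^+ j * \sum_(k < M * f | coprime k f) (k%:R ^+ j)^-1.
Proof.
move=> f1 jN.
pose h (a : nat) : R := \sum_(s < M) ((s%:R + a%:R / f%:R) ^+ j)^-1.
have fR : f%:R != 0 :> R by rewrite pnatr_eq0; lia.
have -> : \sum_(1 <= a < f | coprime a f) cotsum j M (a%:R / f%:R : R) =
   \sum_(1 <= a < f | coprime a f) (h a + h (f - a)%N).
  rewrite big_nat_cond [RHS]big_nat_cond; apply: eq_bigr => a /andP[/andP[a1 af] _].
  rewrite cotsum_fold big_split -signr_odd (negbTE jN) expr0 /=; congr (_ + _).
  apply: eq_bigr => s _; rewrite mul1r natrB 1?ltnW//.
  by congr ((_ ^+ _)^-1); field.
rewrite big_split /= [X in _ + X]big_nat_rev /= add1n.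
have -> : \sum_(1 <= i < f | coprime (f.+1 - i.+1) f) h (f - (f.+1 - i.+1))%N =
   \sum_(1 <= a < f | coprime a f) h a.
  rewrite [LHS]big_nat_cond [RHS]big_nat_cond; apply: eq_big => [a|a].
    by case: (boolP (0 < a < f)%N) => //= /andP[a1 af]; rewrite subSS coprime_subl// ltnW.
  by move=> /andP[/andP[a1 af] _]; rewrite subSS subKn// ltnW.
rewrite -mulr2n -[LHS]mulr_natl -mulrA; congr (_ * _).
rewrite /h big_mkcond [in RHS]big_mkcond /=.
rewrite (sum_blocks f M (fun k => if coprime k f then (k%:R ^+ j)^-1 else 0)).
rewrite big_distrr /=.
under [RHS]eq_bigr => s _.
  rewrite -(big_mkord xpredT (fun r => if coprime (s * f + r) f then ((s * f + r)%:R ^+ j)^-1 else 0)).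
  rewrite big_ltn; last by lia.
  rewrite ifF; last first.
    apply/negP; rewrite addn0 /coprime gcdnC gcdnMl; lia.
  rewrite add0r big_distrr.
  over.
rewrite exchange_big /=; apply: eq_bigr => a _.
have E s : coprime (s * f + a) f = coprime a f.
  by rewrite ![coprime _ f]coprime_sym /coprime gcdnMDl.
under [RHS]eq_bigr do rewrite E.
case: ifP => _; last by rewrite big1 // => s _; rewrite mulr0.
apply: eq_bigr => s _.
have -> : s%:R + a%:R / f%:R = (s * f + a)%:R / f%:R :> R.
  by rewrite natrD natrM; field.
by rewrite expr_div_n invf_div mulrC.
Qed.

(** For odd j the reflection a -> f - a makes the left side its own negative. This covers j = 1
    although [zeta R 1] is meaningless, since its factor in [zeta2] is 0. *)
Lemma sum_coprime_cotfun (R : realType) (f j : nat) : (1 < f)%N -> (0 < j)%N ->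
  \sum_(1 <= a < f | coprime a f) cotfun j (a%:R / f%:R : R) =
  f%:R ^+ j * (zeta2 R j * phi_ R j f).
Proof.
move=> f1 j0; have [jo|je] := boolP (odd j).
  rewrite /zeta2 -signr_odd jo expr1 subrr !mul0r mulr0.
  have e : \sum_(1 <= a < f | coprime a f) cotfun j (a%:R / f%:R : R) =
    - \sum_(1 <= a < f | coprime a f) cotfun j (a%:R / f%:R : R).
    rewrite {1}big_nat_rev /= add1n -sumrN [LHS]big_nat_cond [RHS]big_nat_cond.
    apply: eq_big => [a|a].
      by case: (boolP (0 < a < f)%N) => //= /andP[a1 af]; rewrite subSS coprime_subl// ltnW.
    move=> /andP[/andP[a1 af]]; rewrite subSS coprime_subl 1?ltnW// => caf.
    have -> : (f - a)%:R / f%:R = 1 - a%:R / f%:R :> R.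
      rewrite natrB 1?ltnW//; field; rewrite pnatr_eq0; lia.
    by rewrite cotfunN ?frac01// -signr_odd jo expr1 mulN1r.
  have self_opp0 (z : R) : z = - z -> z = 0 by lra.
  exact: self_opp0 e.
have cl : (fun M => \sum_(1 <= a < f | coprime a f) cotsum j M (a%:R / f%:R : R)) @ \oo
   --> \sum_(1 <= a < f | coprime a f) cotfun j (a%:R / f%:R : R).
  rewrite big_nat_cond; under eq_fun do rewrite big_nat_cond.
  apply: cvgn_sum => a /andP[/andP[a1 af] caf].
  by apply: cotsum_cvg => //; exact: frac01.
rewrite -(cvg_lim _ cl) //; apply: cvg_lim => //.
under eq_fun do rewrite sum_coprime_cotsum//.
rewrite /zeta2 -signr_odd (negbTE je) expr0.
have -> : f%:R ^+ j * ((1 + 1) * zeta R j * phi_ R j f) =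
  2 * f%:R ^+ j * (zeta R j * phi_ R j f) by ring.
apply: cvgM; first exact: cvg_cst.
have j1 : (1 < j)%N by case: j j0 je {cl} => // -[].
have hf M : (M <= M * f)%N by rewrite leq_pmulr//; lia.
exact: subseq_cvg hf (@coprime_zeta_cvg R f j f1 j1).
Qed.

Lemma cotfun_half (R : realType) (j : nat) : (0 < j)%N ->
  cotfun j (2^-1 : R) = (2 ^+ j - 1) * zeta2 R j.
Proof.
move=> j0; have := @sum_coprime_cotfun R 2 j isT j0.
rewrite big_ltn_cond// big_geq// coprime1n addr0 mul1r => ->.
have -> : phi_ R j 2 = 1 - (2 ^+ j)^-1.
  by rewrite /phi_ (_ : primes 2 = [:: 2%N])// big_seq1.
by field; rewrite expf_neq0.
Qed.

Lemma sum_even_terms (V : nmodType) (m : nat) (F : nat -> V) :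
  (forall j, odd j -> F j = 0) ->
  \sum_(1 <= j < m.+1) F j = \sum_(1 <= k < m./2.+1) F (2 * k)%N.
Proof.
move=> F0; elim: m => [|m IH]; first by rewrite !big_geq.
rewrite big_nat_recr//= IH uphalf_half.
have [mo|me] := boolP (odd m).
  rewrite add1n [RHS]big_nat_recr//=; congr (_ + F _).
  by rewrite mulnS mul2n -{1}(odd_double_half m) mo.
by rewrite add0n F0 ?addr0//= me.
Qed.

Lemma zeta2_even (R : realType) (k : nat) : zeta2 R (2 * k) = 2 * zeta R (2 * k).
Proof. by rewrite /zeta2 exprM sqrrN !expr1n. Qed.

Lemma zeta2_odd (R : realType) (e : nat) : odd e -> zeta2 R e = 0.
Proof. by move=> eo; rewrite /zeta2 -signr_odd eo expr1 subrr mul0r. Qed.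

Lemma zeta_recursion (R : realType) (r : nat) : (1 < r)%N ->
  (4 ^+ r - 1) * zeta R (2 * r) =
  2 * \sum_(1 <= k < r) (4 ^+ k - 1) * (zeta R (2 * k) * zeta R (2 * (r - k))).
Proof.
move=> r1; have half01 : 0 < (2^-1 : R) < 1 by lra.
have c1 : cotfun 1 (2^-1 : R) = 0 by rewrite cotfun_half// zeta2_odd ?mulr0.
have := @cotfun_mul R 1 (2 * r - 1) _ isT ltac:(lia) ltac:(lia) half01.
(* [cotfun 1] vanishes at 1/2, so the product and the polar half that involves only [cotfun 1] both
   drop out, leaving a relation between zeta values. *)
rewrite c1 mul0r big_ord1 subn0 c1 !mulr0 addr0.
have -> : (1 + (2 * r - 1) = 2 * r)%N by lia.
rewrite cotfun_half ?zeta2_even; last by lia.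
pose F j : R := - ((-1) ^+ j * (zeta2 R j * ((2 ^+ (2 * r - j) - 1) * zeta2 R (2 * r - j)))).
have -> : \sum_(i < 2 * r - 1) (-1) ^+ i * (pfc 1 i)%:R *
     (zeta2 R (1 + i) * cotfun (2 * r - 1 - i) 2^-1) = \sum_(1 <= j < (2 * r - 1).+1) F j.
  rewrite big_add1 big_mkord; apply: eq_bigr => i _.
  rewrite /F /pfc add1n /= binn mulr1 exprS cotfun_half; last by have := ltn_ord i; lia.
  have -> : (2 * r - 1 - i = 2 * r - i.+1)%N by lia.
  ring.
rewrite sum_even_terms => [|j jo]; last by rewrite /F zeta2_odd ?mul0r ?mulr0 ?oppr0.
have -> : (2 * r - 1)./2.+1 = r by lia.
have -> : \sum_(1 <= k < r) F (2 * k)%N = - (4 * \sum_(1 <= k < r)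
    (4 ^+ k - 1) * (zeta R (2 * k) * zeta R (2 * (r - k)))).
  (* Reversing k -> r - k turns the weight 2^(2r - 2k) - 1 into 4^k - 1, the form of the Bernoulli
     recursion. *)
  rewrite big_nat_rev /= big_distrr -sumrN /= big_nat_cond [RHS]big_nat_cond.
  apply: eq_bigr => k /andP[/andP[k1 kr] _].
  rewrite /F add1n subSS.
  have -> : (2 * r - 2 * (r - k) = 2 * k)%N by lia.
  rewrite !zeta2_even !exprM sqrrN !expr1n.
  have -> : 2 ^+ 2 = 4 :> R by ring.
  ring.
have -> : 2 ^+ (2 * r) = 4 ^+ r :> R by rewrite exprM; congr (_ ^+ _); ring.
by move: (\sum_(_ <= _ < _) _) => S; lra.
Qed.

(** * Bernoulli numbers and zeta values *)

(* F t = O(t^N) at 0; the value F 0 is irrelevant. *)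
Definition flat (R : realType) (N : nat) (F : R -> R) : Prop :=
  exists C d : R, 0 < d /\ forall t, 0 < `|t| < d -> `|F t| <= C * `|t| ^+ N.

Lemma flat_ext (R : realType) (N : nat) (F G : R -> R) :
  (forall t, t != 0 -> F t = G t) -> flat N F -> flat N G.
Proof.
move=> FG [C [d [d0 H]]]; exists C, d; split => // t td.
by rewrite -FG ?H//; case/andP: td => t0 _; rewrite -normr_gt0.
Qed.

Lemma flatN (R : realType) (N : nat) (F : R -> R) :
  flat N F -> flat N (fun t => - F t).
Proof. by move=> [C [d [d0 H]]]; exists C, d; split => // t td; rewrite normrN H. Qed.

Lemma flatW (R : realType) (M N : nat) (F : R -> R) : (M <= N)%N ->
  flat N F -> flat M F.
Proof.
move=> MN [C [d [d0 H]]]; exists `|C|, (Num.min d 1); split; first by rewrite lt_min d0/=.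
move=> t /andP[t0]; rewrite lt_min => /andP[td t1].
apply: le_trans (H _ _) _; first by rewrite t0.
apply: (@le_trans _ _ (`|C| * `|t| ^+ N)); first by rewrite ler_wpM2r ?exprn_ge0// ler_norm.
by rewrite ler_wpM2l// ler_wiXn2l// ltW.
Qed.

Lemma flatD (R : realType) (N : nat) (F G : R -> R) :
  flat N F -> flat N G -> flat N (fun t => F t + G t).
Proof.
move=> [C [d [d0 HF]]] [D [e [e0 HG]]]; exists (C + D), (Num.min d e).
split; first by rewrite lt_min d0.
move=> t /andP[t0]; rewrite lt_min => /andP[td te].
apply: le_trans (ler_normD _ _) _; rewrite mulrDl lerD//.
  by apply: HF; rewrite t0.
by apply: HG; rewrite t0.
Qed.

Lemma flatM (R : realType) (M N : nat) (F G : R -> R) :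
  flat M F -> flat N G -> flat (M + N) (fun t => F t * G t).
Proof.
move=> [C [d [d0 HF]]] [D [e [e0 HG]]]; exists (C * D), (Num.min d e).
split; first by rewrite lt_min d0.
move=> t /andP[t0]; rewrite lt_min => /andP[td te].
rewrite normrM exprD mulrACA; apply: ler_pM => //.
  by apply: HF; rewrite t0.
by apply: HG; rewrite t0.
Qed.

Lemma flat_horner (R : realType) (p : {poly R}) : flat 0 (fun t => p.[t]).
Proof.
exists (\sum_(i < size p) `|p`_i|), 1; split => // t /andP[t0 t1].
rewrite expr0 mulr1 horner_coef; apply: le_trans (ler_norm_sum _ _ _) _.
apply: ler_sum => i _; rewrite normrM normrX ler_piMr//.
by rewrite exprn_ile1// ltW.
Qed.

Lemma flat_const (R : realType) (c : R) : flat 1 (fun _ => c) -> c = 0.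
Proof.
move=> [C [d [d0 H]]]; apply/eqP; rewrite -normr_le0; apply/ler_addgt0Pr => e e0.
rewrite add0r.
pose t := Num.min (d / 2) (e / (`|C| + 1)).
have C1 : 0 < `|C| + 1 by rewrite ltr_wpDl.
have t0 : 0 < t by rewrite lt_min !divr_gt0.
have td : t <= d / 2 by rewrite ge_min lexx.
have te : t <= e / (`|C| + 1) by rewrite ge_min lexx orbT.
have := H t; rewrite gtr0_norm// t0 expr1 => /(_ ltac:(lra)) /le_trans; apply.
apply: (@le_trans _ _ ((`|C| + 1) * t)).
  by rewrite ler_wpM2r ?ltW//; have := ler_norm C; lra.
by rewrite mulrC -ler_pdivlMr.
Qed.

Lemma flat_poly (R : realType) (N : nat) (p : {poly R}) :
  flat N (fun t => p.[t]) -> forall i, (i < N)%N -> p`_i = 0.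
Proof.
elim/poly_ind: p N => [|p c IH] N Hp i iN; first by rewrite coef0.
have c0 : c = 0.
  apply: flat_const.
  apply: (@flat_ext _ _ (fun t => (p * 'X + c%:P).[t] + (- p * 'X).[t])).
    by move=> t _; rewrite !hornerE; ring.
  apply: flatD.
    by apply: flatW Hp; lia.
  apply: (@flat_ext _ _ (fun t => (- p).[t] * t)).
    by move=> t _; rewrite !hornerE.
  apply: (@flatM _ 0 1); first exact: flat_horner.
  by exists 1, 1; split => // t _; rewrite mul1r expr1.
rewrite c0 addr0 coefMX; case: i iN => [//|i] iN /=.
case: N Hp iN => // N Hp iN; apply: (IH N) => //.
move: Hp; rewrite c0 addr0 => -[C [d [d0 H]]]; exists C, d; split => // t td.
have := H t td; rewrite hornerMX normrM exprSr mulrA ler_pM2r//.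
by case/andP: td.
Qed.

(** An asymptotic expansion at 0. It is stable under scaling, sums and products and fixes its
    coefficients below N, so functional equations become coefficient identities without multiplying
    or rearranging infinite series. *)
Definition expansion (R : realType) (N : nat) (F : R -> R) (c : nat -> R) : Prop :=
  flat N (fun t => F t - (\poly_(k < N) c k).[t]).

Lemma expansion_scale (R : realType) (N : nat) (F : R -> R) (c : nat -> R) (a : R) :
  a != 0 ->
  expansion N F c -> expansion N (fun t => F (a * t)) (fun k => a ^+ k * c k).
Proof.
move=> a0 [C [d [d0 H]]]; exists (C * `|a| ^+ N), (d / `|a|).
have na0 : 0 < `|a| by rewrite normr_gt0.
split; first by rewrite divr_gt0.
move=> t /andP[t0 td]; have := H (a * t).
rewrite normrM mulr_gt0//= mulrC -ltr_pdivlMr// td => /(_ isT).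
rewrite exprMn [_ ^+ N * _]mulrC mulrA.
by congr (`|_ - _| <= _); rewrite !horner_poly; apply: eq_bigr => i _;
  rewrite exprMn; ring.
Qed.

Lemma expansionD (R : realType) (N : nat) (F G : R -> R) (c d : nat -> R) :
  expansion N F c -> expansion N G d ->
  expansion N (fun t => F t + G t) (fun k => c k + d k).
Proof.
move=> Fc Gd; apply: flat_ext (flatD Fc Gd) => t _.
rewrite !horner_poly; under [in RHS]eq_bigr do rewrite mulrDl.
by rewrite big_split /=; ring.
Qed.

Lemma expansionB (R : realType) (N : nat) (F G : R -> R) (c d : nat -> R) :
  expansion N F c -> expansion N G d ->
  expansion N (fun t => F t - G t) (fun k => c k - d k).
Proof.
move=> Fc Gd; apply: flat_ext (flatD Fc (flatN Gd)) => t _.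
rewrite !horner_poly; under [in RHS]eq_bigr do rewrite mulrBl.
by rewrite sumrB /=; ring.
Qed.

Lemma expansion_monomial (R : realType) (N j : nat) (a : R) : (j < N)%N ->
  expansion N (fun t => a * t ^+ j) (fun k => if k == j then a else 0).
Proof.
move=> jN; exists 0, 1; split => // t _.
rewrite horner_poly (bigD1 (Ordinal jN)) //= eqxx big1 ?addr0 ?subrr ?normr0 ?mul0r//.
by move=> i; rewrite -val_eqE /= => /negbTE ->; rewrite mul0r.
Qed.

Lemma expansion_uniq (R : realType) (N : nat) (F : R -> R) (c d : nat -> R) :
  expansion N F c -> expansion N F d -> forall k, (k < N)%N -> c k = d k.
Proof.
move=> Fc Fd k kN; apply/eqP; rewrite -subr_eq0; apply/eqP.
have : flat N (fun t => (\poly_(k < N) c k - \poly_(k < N) d k).[t]).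
  by apply: flat_ext (flatD Fd (flatN Fc)) => t _; rewrite !hornerE; ring.
by move/flat_poly => /(_ k kN); rewrite coefB !coef_poly kN.
Qed.

Lemma expansion_bounded (R : realType) (N : nat) (F : R -> R) (c : nat -> R) :
  expansion N F c -> flat 0 F.
Proof.
move=> Fc; apply: flat_ext (flatD (flatW (leq0n N) Fc) (flat_horner (\poly_(k < N) c k))).
by move=> t _; rewrite subrK.
Qed.

(** With P and Q the truncations of F and G, F G - P Q = F (G - Q) + (F - P) Q is O(t^N), because F
    and Q stay bounded near 0. So P Q and the truncation of H agree below degree N. *)
Lemma expansionM (R : realType) (N : nat) (F G H : R -> R) (c d e : nat -> R) :
  expansion N F c -> expansion N G d -> expansion N H e ->
  (forall t, t != 0 -> F t * G t = H t) ->
  forall k, (k < N)%N -> \sum_(i < k.+1) c i * d (k - i)%N = e k.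
Proof.
move=> Fc Gd He FGH k kN.
pose P := \poly_(k < N) c k; pose Q := \poly_(k < N) d k; pose S := \poly_(k < N) e k.
have FG : flat N (fun t => F t * (G t - Q.[t])) := flatM (expansion_bounded Fc) Gd.
have FQ : flat N (fun t => (F t - P.[t]) * Q.[t]).
  by rewrite -[N]addn0; apply: flatM (flat_horner _).
have : flat N (fun t => (P * Q - S).[t]).
  apply: flat_ext (flatD He (flatN (flatD FG FQ))) => t t0.
  rewrite -(FGH t t0) hornerD hornerM hornerN -/S; ring.
move/flat_poly => /(_ k kN); rewrite coefB coefM coef_poly kN => /eqP.
rewrite subr_eq0 => /eqP <-; apply: eq_bigr => i _.
by rewrite !coef_poly !ifT//; have := ltn_ord i; lia.
Qed.

Lemma power_series_expansion (R : realType) (c : nat -> R) (F : R -> R) (N : nat) :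
  (\forall t \near (0 : R)^', series (fun k => c k * t ^+ k) @ \oo --> F t) ->
  expansion N F c.
Proof.
rewrite /dnbhs /within /= => /nbhs_ballP[r /= r0 H].
have {}H t : 0 < `|t| < r -> series (fun k => c k * t ^+ k) @ \oo --> F t.
  move=> /andP[t0 tr]; apply: H; last by rewrite -normr_gt0.
  by rewrite /ball /= sub0r normrN.
have [s [s0 sr]] : exists s, 0 < s /\ s < r by exists (r / 2); split; lra.
have [M [M0 HM]] : exists M, 0 < M /\ forall k, `|c k * s ^+ k| <= M.
  have cs : cvgn (series (fun k => c k * s ^+ k)).
    by apply/cvg_ex; exists (F s); apply: H; rewrite gtr0_norm// s0.
  have := cvg_series_cvg_0 cs.
  move=> /cvgP /cvg_seq_bounded [A [Ar HA]].
  exists (`|A| + 1); split; first by rewrite ltr_wpDl.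
  by move=> k; apply: HA => //; have := ler_norm A; lra.
(* The terms at the point s of convergence are bounded by M. For |t| < s / 2 the tail from N on is
   dominated by M q^N (1 + q + ...) with q = |t| / s <= 1/2, hence by 2 M q^N. *)
exists (2 * M / s ^+ N), (s / 2); split; first by rewrite divr_gt0.
move=> t /andP[t0 ts].
have ct := H t; rewrite t0 /= in ct.
have {}ct : series (fun k => c k * t ^+ k) @ \oo --> F t by apply: ct; lra.
pose q := `|t| / s.
have q0 : 0 <= q by rewrite divr_ge0// ltW.
have q1 : q <= 2^-1 by rewrite ler_pdivrMr//; lra.
have term k : `|c k * t ^+ k| <= M * q ^+ k.
  have -> : c k * t ^+ k = (c k * s ^+ k) * (t / s) ^+ k.
    have sk0 : s ^+ k != 0 by rewrite expf_neq0// gt_eqF.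
    by rewrite expr_div_n mulrACA divff// mulr1.
  rewrite normrM (normrX k (t / s)) (normrM t) normfV (gtr0_norm s0).
  by rewrite ler_wpM2r ?exprn_ge0.
have geo n : M * q ^+ N * (\sum_(i < n) q ^+ i) <= 2 * M / s ^+ N * `|t| ^+ N.
  have -> : 2 * M / s ^+ N * `|t| ^+ N = M * q ^+ N * 2.
    by rewrite /q expr_div_n; ring.
  rewrite ler_wpM2l ?mulr_ge0 ?exprn_ge0 ?(ltW M0)//.
  suff : (1 - q) * (\sum_(i < n) q ^+ i) <= 1.
    move=> h; have S0 : 0 <= \sum_(i < n) q ^+ i by apply: sumr_ge0 => i _; rewrite exprn_ge0.
    move: (\sum_(_ < n) _) S0 h => S S0 h; nra.
  by rewrite -opprB mulNr -subrX1 opprB lerBlDr lerDl exprn_ge0.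
have cN : (fun n => `|series (fun k => c k * t ^+ k) (N + n)%N - (\poly_(k < N) c k).[t]|)
    @ \oo --> `|F t - (\poly_(k < N) c k).[t]|.
  apply: cvg_norm; apply: cvgB; last exact: cvg_cst.
  by apply: subseq_cvg ct => n; rewrite leq_addl.
rewrite -(cvg_lim _ cN)//; apply: limr_le; first by apply/cvg_ex; eexists; exact: cN.
near=> n.
rewrite /series /= big_mkord big_split_ord horner_poly /= addrAC subrr add0r.
apply: le_trans (ler_norm_sum _ _ _) _; apply: le_trans (geo n).
by rewrite big_distrr; apply: ler_sum => i _ /=; rewrite -mulrA -exprD.
Unshelve. all: by end_near. Qed.

Lemma expR_sub1_neq0 (R : realType) (t : R) : t != 0 -> expR t - 1 != 0.
Proof.
move=> t0; rewrite subr_eq0; apply: contra_neq t0 => e.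
have := expR_gt1 t; have := expR_lt1 t; rewrite e ltxx => /esym/negbT + /esym/negbT.
by rewrite -!leNgt => a b; apply/eqP; rewrite eq_le a b.
Qed.

Section Bernoulli.
Variables (R : realType) (B : nat -> R).
Hypothesis hB : is_bernoulli B.

(* The coefficients of (t / 2) coth (t / 2). *)
Let beta k : R := B k / k`!%:R + (if k == 1%N then 2^-1 else 0).
Let h (t : R) : R := t / (expR t - 1) + 2^-1 * t ^+ 1.

Let h_expansion N : (1 < N)%N -> expansion N h beta.
Proof.
move=> N1; apply: expansionD; last exact: expansion_monomial.
exact: power_series_expansion hB.
Qed.

Let hN t : t != 0 -> h (- t) = h t.
Proof.
move=> t0; have e1 := expR_sub1_neq0 t0.
have e0 : expR t != 0 by rewrite gt_eqF ?expR_gt0.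
have e1' : 1 + -1 * expR t != 0 by rewrite mulN1r -opprB oppr_eq0.
rewrite /h expRN; field.
by rewrite e0 e1 e1'.
Qed.

(** The duplication formula 2 coth t = coth(t/2) + tanh(t/2) makes h(2t) - h(t) equal to (t/2)
    tanh(t/2). *)
Let h_functional t : t != 0 -> (h (2 * t) - h t) * h t = 4^-1 * t ^+ 2.
Proof.
move=> t0; have e1 := expR_sub1_neq0 t0.
have t20 : 2 * t != 0 by rewrite mulf_neq0.
have := expR_sub1_neq0 t20; rewrite /h -[2]/(2%:R) expRM_natl => e2.
move: (expR t) e1 e2 => e e1 e2; field.
by rewrite e1 e2.
Qed.

Let beta_odd k : odd k -> beta k = 0.
Proof.
move=> ko; have E := @h_expansion k.+2 isT.
have := expansion_scale (a := -1) _ E; rewrite oppr_eq0 oner_neq0 => /(_ isT) E'.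
have E'' : expansion k.+2 h (fun k => (-1) ^+ k * beta k).
  by apply: flat_ext E' => t t0; rewrite mulN1r hN.
have /= := expansion_uniq E E'' (ltnW (ltnSn k.+1)).
by rewrite -signr_odd ko expr1; lra.
Qed.

(** The functional equation is unchanged by h -> -h, so it cannot fix the sign of the constant
    coefficient. The normalization comes from the coefficient of t in (t / (e^t - 1)) (e^t - 1) =
    t. *)
Let beta0 : beta 0 = 1.
Proof.
have gE : expansion 2 (fun t => t / (expR t - 1)) (fun k => B k / k`!%:R).
  exact: power_series_expansion hB.
have eE : expansion 2 (@expR R) (fun k => k`!%:R^-1).
  apply: power_series_expansion; near=> t.
  rewrite (_ : series _ = series (exp_coeff t)); first exact: is_cvg_series_exp_coeff.
  by congr series; apply/funext => k; rewrite /exp_coeff /= mulrC.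
have e1E := expansionB eE (expansion_monomial 1 (isT : (0 < 2)%N)).
have := expansionM gE e1E (expansion_monomial 1 (isT : (1 < 2)%N)).
move=> /(_ _ 1%N isT); rewrite !big_ord_recl big_ord0 /= => H.
rewrite /beta /= addr0 -[RHS]H; first by rewrite !fact0 !invr1; ring.
by move=> t t0; rewrite expr0 expr1 mulr1 mul1r divfK// expR_sub1_neq0.
Unshelve. all: by end_near. Qed.

Let beta_convolution k :
  \sum_(i < k.+1) (2 ^+ i * beta i - beta i) * beta (k - i)%N =
  if k == 2%N then 4^-1 else 0.
Proof.
have E := @h_expansion k.+3 isT.
have t0 : (2 : R) != 0 by rewrite pnatr_eq0.
have E2 := expansionB (expansion_scale t0 E) E.
have E4 := expansion_monomial (4^-1 : R) (isT : (2 < k.+3)%N).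
by apply: (expansionM E2 E E4 h_functional); lia.
Qed.

Let b k : R := B (2 * k) / (2 * k)`!%:R.

Let beta_even k : beta (2 * k) = b k.
Proof. by rewrite /beta ifF ?addr0//; lia. Qed.

Let b_convolution r : (0 < r)%N ->
  (4 ^+ r - 1) * b r + \sum_(1 <= k < r) (4 ^+ k - 1) * (b k * b (r - k)) =
  if r == 1%N then 4^-1 else 0.
Proof.
move=> r0; have := beta_convolution (2 * r).
rewrite -(big_mkord xpredT (fun i => (2 ^+ i * beta i - beta i) * beta (2 * r - i)%N)).
(* The term i = 0 vanishes because doubling t fixes the constant coefficient; the top term i = 2 r
   supplies (4^r - 1) [b r] through [beta0]. *)
rewrite big_ltn// expr0 mul1r subrr mul0r add0r sum_even_terms => [|j jo]; last first.
  by rewrite beta_odd// mulr0 subr0 mul0r.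
rewrite (_ : (2 * r)./2 = r); last by lia.
rewrite big_nat_recr//= subnn beta0 mulr1 addrC beta_even.
have -> : (2 * r == 2)%N = (r == 1)%N by lia.
move=> <-; congr (_ + _).
  by rewrite exprM (_ : 2 ^+ 2 = 4); ring.
rewrite big_nat_cond [RHS]big_nat_cond; apply: eq_bigr => k /andP[/andP[k1 kr] _].
rewrite -mulnBr !beta_even exprM (_ : 2 ^+ 2 = 4 :> R); ring.
Qed.

Lemma bernoulli_zeta : exists2 c : R, c != 0 &
  forall r, (0 < r)%N -> B (2 * r) / (2 * r)`!%:R = - 2 * c ^+ r * zeta R (2 * r).
Proof.
have z1 := zeta_ge1 R (isT : (1 < 2)%N).
have z0 : zeta R 2 != 0 by rewrite gt_eqF//; lra.
(* Forced by r = 1, where 3 * [b 1] = 1/4 gives [b 1] = 1/12. Classically c = -1 / (4 pi^2). *)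
have [c c0 cE] : exists2 c : R, c != 0 & c * (24 * zeta R 2) = - 1.
  exists (- (24 * zeta R 2)^-1); first by rewrite oppr_eq0 invr_eq0 mulf_neq0.
  by field.
exists c => //.
move=> r; rewrite -/(b r); have [n] := ubnP r; elim: n r => // n IH r rn r0.
have := b_convolution r0.
have [->|r1] := eqVneq r 1%N.
  rewrite big_geq// addr0 muln1 !expr1 => H.
  lra.
have {}r1 : (1 < r)%N by lia.
have r4 : 4 ^+ r - 1 != 0 :> R.
  by rewrite subr_eq0 gt_eqF// exprn_egt1 ?ltr1n//; lia.
move/eqP; rewrite addr_eq0 => /eqP H.
apply: (mulfI r4); rewrite H.
have -> : \sum_(1 <= k < r) (4 ^+ k - 1) * (b k * b (r - k)) =
  4 * c ^+ r * \sum_(1 <= k < r) (4 ^+ k - 1) * (zeta R (2 * k) * zeta R (2 * (r - k))).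
  rewrite big_distrr /= [LHS]big_nat_cond [RHS]big_nat_cond.
  apply: eq_bigr => k /andP[/andP[k1 kr] _].
  rewrite IH; [|lia|lia]; rewrite IH; [|lia|lia].
  have -> : c ^+ r = c ^+ k * c ^+ (r - k) by rewrite -exprD subnKC// ltnW.
  move: (c ^+ k) (c ^+ (r - k)) (4 ^+ k : R) => x y z; ring.
have := zeta_recursion R r1.
move: (\sum_(_ <= _ < _) _) => S HS.
have -> : (4 ^+ r - 1) * (- 2 * c ^+ r * zeta R (2 * r)) =
  - 2 * c ^+ r * ((4 ^+ r - 1) * zeta R (2 * r)) by ring.
by rewrite HS; ring.
Qed.

End Bernoulli.

(** * Dirichlet characters *)

(** The minimal polynomial divides X^k - 1, which splits with simple roots in characteristic 0. *)
Lemma diagonalizable_finite_order (K : numClosedFieldType) (n k : nat)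
    (A : 'M[K]_n.+1) : (0 < k)%N -> A ^+ k = 1 ->
  mxpoly.simmx_in_to unitmx A is_diag_mx.
Proof.
move=> k0 Ak.
have [s sE] := closed_field_poly_normal ('X^k - 1 : {poly K}).
rewrite (monicP _) ?scale1r in sE; last exact: monicXnsubC.
apply/mxpoly.diagonalizableP; exists s.
  rewrite -separable_prod_XsubC -sE cyclotomic.separable_Xn_sub_1//.
  by rewrite pnatr_eq0; lia.
rewrite -sE; apply: mxminpoly_min.
by rewrite rmorphB rmorphXn /= horner_mx_X rmorph1 Ak subrr.
Qed.

(* The commuting matrices of a representation diagonalize simultaneously, and
   each diagonal entry is a linear character. *)
Lemma abelian_repr_separates (K : numClosedFieldType) (gT : finGroupType)
    (G : {group gT}) (n : nat) (rG : mx_representation K G n) (g : gT) :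
  abelian G -> g \in G -> rG g <> 1%:M ->
  exists lam : gT -> K, [/\ lam 1%g = 1,
    {in G &, {morph lam : x y / (x * y)%g >-> x * y}} & lam g <> 1].
Proof.
move=> cGG gG; case: n rG => [|n] rG rg1; first by case: rg1; rewrite [LHS]flatmx0 [RHS]flatmx0.
have : mxpoly.all_simmx_in unitmx [seq rG x | x <- enum G] is_diag_mx.
  apply/mxpoly.codiagonalizableP; split.
    move=> _ _ /mapP[x + ->] /mapP[y + ->]; rewrite !mem_enum => xG yG.
    by rewrite /comm_mx -!repr_mxM// (centsP cGG x xG y yG).
  move=> _ /mapP[x + ->]; rewrite mem_enum => xG.
  apply: (@diagonalizable_finite_order _ _ #|G|); first exact: cardG_gt0.
  by rewrite -repr_mxX// expg_cardG// repr_mx1.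
move=> [P uP /allP Pdiag].
pose D x := P *m rG x *m invmx P.
have Dd x : x \in G -> is_diag_mx (D x).
  by move=> xG; rewrite /D -mxpoly.conjumx//; apply: (Pdiag (rG x)); rewrite map_f// mem_enum.
have D1 : D 1%g = 1%:M by rewrite /D repr_mx1 mulmx1 mulmxV.
have DM x y : x \in G -> y \in G -> D (x * y)%g = D x *m D y.
  by move=> xG yG; rewrite /D repr_mxM// !mulmxA mulmxKV.
have DE x y i : x \in G -> y \in G -> D (x * y)%g i i = D x i i * D y i i.
  move=> xG yG; rewrite DM// mxE (bigD1 i)//= big1 ?addr0// => j ji.
  by have /is_diag_mxP -> := Dd x xG; rewrite ?mul0r// eq_sym.
have [i Dgi] : exists i, D g i i != 1.
  case: (pickP (fun i => D g i i != 1)) => [i Dgi|Dg1]; [by exists i|case: rg1].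
  have Dg : D g = 1%:M.
    apply/matrixP => i j; rewrite [RHS]mxE; case: (eqVneq i j) => [->|ij].
      by apply/eqP; have /negbT := Dg1 j; rewrite negbK.
    by have /is_diag_mxP -> := Dd g gG.
  have : invmx P *m D g *m P = rG g by rewrite /D !mulmxA mulVmx// mul1mx mulmxKV.
  by rewrite Dg mulmx1 mulVmx.
exists (fun x => D x i i); split.
- by rewrite D1 mxE eqxx.
- by move=> x y xG yG; apply: DE.
- exact/eqP.
Qed.

Section Dirichlet.
Variables (R : realType) (f : nat).
Hypothesis f1 : (1 < f)%N.

Local Notation char := {ffun 'Z_f -> R[i]}.
Local Notation N := (totient f).
Local Notation U := [set: {unit 'Z_f}]%G.
Let X : set char := [set chi | is_dirichlet_character chi].

Lemma card_unit_Zp : #|{: {unit 'Z_f}}| = N.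
Proof. by rewrite -card_units_Zp ?cardsT//; lia. Qed.

Lemma unit_exp_totient (a : 'Z_f) : a \is a GRing.unit -> a ^+ N = 1.
Proof.
move=> ua; have := @expg_cardG _ U (FinRing.unit 'Z_f ua) (finset.in_setT _).
by rewrite cardsT card_unit_Zp => /(congr1 val); rewrite FinRing.val_unitX.
Qed.

Lemma dirichlet_char0 chi a : X chi -> a \isn't a GRing.unit -> chi a = 0.
Proof. by move=> [_ _ H] /negbTE ua; apply/eqP; rewrite -[_ == _]negbK H ua. Qed.

Lemma dirichlet_charX chi a k : X chi -> chi (a ^+ k) = chi a ^+ k.
Proof.
move=> [h1 hM _]; elim: k => [|k IH]; first by rewrite !expr0.
by rewrite !exprS hM IH.
Qed.

Lemma dirichlet_char_root chi a : X chi -> a \is a GRing.unit -> chi a ^+ N = 1.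
Proof.
by move=> Xchi ua; rewrite -dirichlet_charX// unit_exp_totient//; case: Xchi.
Qed.

Lemma dirichlet_charV chi a : X chi -> a \is a GRing.unit ->
  (chi a)^*%C = chi a^-1.
Proof.
move=> Xchi ua; have [h1 hM hu] := Xchi.
have chia0 : chi a != 0 by rewrite hu.
apply: (mulfI chia0); rewrite -hM mulrV// h1.
have N0 : (0 < N)%N by rewrite totient_gt0; lia.
have : `|chi a| ^+ N = 1 by rewrite -normrX dirichlet_char_root// normr1.
move/eqP; rewrite pexpr_eq1// => /eqP chi1.
have := normCK (chi a); rewrite chi1 expr1n => ->.
by [].
Qed.

(** The values lie among 0 and the roots of X^N - 1. A sum over a set with infinite support is 0 by
    default, so finiteness is what gives sums over characters their meaning. *)
Lemma finite_dirichlet : finite_set X.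
Proof.
have [s sE] := closed_field_poly_normal ('X^N - 1 : {poly R[i]}).
rewrite (monicP _) ?scale1r in sE; last by apply: monicXnsubC; rewrite totient_gt0; lia.
pose h (g : {ffun 'Z_f -> 'I_(size (0 :: s))}) : char := [ffun a => (0 :: s)`_(g a)].
apply: (@sub_finite_set _ _ [set h g | g in [set: {ffun 'Z_f -> 'I_(size (0 :: s))}]]); last first.
  by apply: finite_image; exact: finite_finset.
move=> chi Xchi.
have mem a : chi a \in 0 :: s.
  have [ua|ua] := boolP (a \is a GRing.unit); last by rewrite dirichlet_char0// mem_head.
  rewrite in_cons; apply/orP; right; rewrite -root_prod_XsubC -sE.
  by rewrite /root !hornerE dirichlet_char_root// subrr.
have lt a : (index (chi a) (0%R :: s) < size (0%R :: s))%N by rewrite index_mem.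
exists [ffun a => Ordinal (lt a)] => //.
by apply/ffunP => a; rewrite !ffunE /= nth_index.
Qed.

(** The regular representation of the unit group is faithful, so a acts nontrivially and some linear
    character differs from 1 at a. Extending it by 0 to the non-units gives a Dirichlet
    character. *)
Lemma dirichlet_separates (a : 'Z_f) : a \is a GRing.unit -> a != 1 ->
  exists2 psi, X psi & psi a != 1.
Proof.
move=> ua a1.
have cGG : abelian U.
  by apply/centsP => x _ y _; apply: val_inj; rewrite /= mulrC.
have [] := @abelian_repr_separates _ _ U _
  (regular_repr R[i] U) (FinRing.unit 'Z_f ua) cGG (finset.in_setT _).
  move=> r1; have : FinRing.unit 'Z_f ua \in rker (regular_repr R[i] U).
    by apply/rkerP; rewrite finset.in_setT.
  move/(fintype.subsetP (regular_mx_faithful _ _)); rewrite inE => /eqP /(congr1 val) /= e.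
  by rewrite e eqxx in a1.
move=> lam [lam1 lamM lama].
pose psi : char := [ffun x => oapp lam 0 (insub x)].
have psiE x (ux : x \is a GRing.unit) : psi x = lam (FinRing.unit 'Z_f ux).
  by rewrite ffunE insubT.
have psi0 x : x \isn't a GRing.unit -> psi x = 0 by move=> ux; rewrite ffunE insubN.
exists psi; last by rewrite psiE; apply/eqP.
split.
- rewrite (psiE _ (unitr1 _)) -[RHS]lam1; congr lam; exact: val_inj.
- move=> x y; have [ux|ux] := boolP (x \is a GRing.unit); last first.
    by rewrite (psi0 x ux) mul0r psi0// unitrM negb_and ux.
  have [uy|uy] := boolP (y \is a GRing.unit); last first.
    by rewrite (psi0 y uy) mulr0 psi0// unitrM negb_and uy orbT.
  have uxy : x * y \is a GRing.unit by rewrite unitrM ux.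
  rewrite !psiE -lamM ?finset.in_setT//; congr lam; exact: val_inj.
- move=> x; have [ux|ux] := boolP (x \is a GRing.unit); last by rewrite psi0// eqxx.
  apply/eqP => p0.
  have uv : x^-1 \is a GRing.unit by rewrite unitrV.
  have : lam (FinRing.unit 'Z_f ux * FinRing.unit 'Z_f uv)%g = 1.
    rewrite -[RHS]lam1; congr lam; apply: val_inj => /=; exact: mulrV.
  by rewrite lamM ?finset.in_setT// -psiE p0 mul0r => /eqP; rewrite eq_sym oner_eq0.
Qed.

Lemma dirichletM psi chi : X psi -> X chi -> X [ffun x => psi x * chi x].
Proof.
move=> [p1 pM pu] [c1 cM cu]; split.
- by rewrite ffunE p1 c1 mulr1.
- by move=> x y; rewrite !ffunE pM cM mulrACA.
- by move=> x; rewrite ffunE mulf_eq0 negb_or pu cu andbb.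
Qed.

Lemma dirichlet_inv psi : X psi -> X [ffun x => (psi x)^-1].
Proof.
move=> [p1 pM pu]; split.
- by rewrite ffunE p1 invr1.
- by move=> x y; rewrite !ffunE pM invfM.
- by move=> x; rewrite ffunE invr_eq0 pu.
Qed.

Lemma dirichlet_principal : X [ffun x => (x \is a GRing.unit)%:R].
Proof.
split.
- by rewrite ffunE unitr1.
- by move=> x y; rewrite !ffunE unitrM -natrM mulnb.
- by move=> x; rewrite ffunE pnatr_eq0 eqb0 negbK.
Qed.

Lemma sum_dirichlet_translate psi (F : char -> R[i]) : X psi ->
  \sum_(chi \in X) F chi = \sum_(chi \in X) F [ffun x => psi x * chi x].
Proof.
move=> Xpsi; apply: (@reindex_fsbig _ _ _ _ _ (fun chi : char => [ffun x => psi x * chi x]) X X F).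
have [p1 pM pu] := Xpsi.
split.
- by move=> chi Xchi; exact: dirichletM.
- move=> chi xi /set_mem Xchi /set_mem Xxi /ffunP e; apply/ffunP => x.
  have := e x; rewrite !ffunE.
  have [ux|ux] := boolP (x \is a GRing.unit); last by rewrite !dirichlet_char0.
  by apply: mulfI; rewrite pu.
- move=> chi Xchi; exists [ffun x => (psi x)^-1 * chi x].
    have -> : [ffun x => (psi x)^-1 * chi x] = [ffun x => [ffun y => (psi y)^-1] x * chi x].
      by apply/ffunP => x; rewrite !ffunE.
    by apply: dirichletM => //; exact: dirichlet_inv.
  apply/ffunP => x; rewrite !ffunE.
  have [ux|ux] := boolP (x \is a GRing.unit); last by rewrite !(dirichlet_char0 _ ux)// mul0r.
  by rewrite mulrA divff ?mul1r// pu.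
Qed.

Lemma sum_dirichlet_neq1 a : a \is a GRing.unit -> a != 1 ->
  \sum_(chi \in X) chi a = 0.
Proof.
move=> ua a1; have [psi Xpsi psia] := dirichlet_separates ua a1.
have := sum_dirichlet_translate (fun chi => chi a) Xpsi.
under [X in _ = X -> _]eq_fsbigr do rewrite ffunE.
rewrite -mulr_fsumr => /eqP; rewrite -subr_eq0 -{1}[\sum_(_ \in _) _]mul1r -mulrBl.
by rewrite mulf_eq0 subr_eq0 eq_sym (negbTE psia) /= => /eqP.
Qed.

Lemma sum_units_dirichlet chi : X chi ->
  \sum_(a : 'Z_f | a \is a GRing.unit) chi a =
  if chi == [ffun x => (x \is a GRing.unit)%:R] then N%:R else 0.
Proof.
move=> Xchi; case: eqP => [->|chi1].
  under eq_bigr => a ua do rewrite ffunE ua.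
  rewrite sumr_const -card_unit_Zp; by rewrite card_sub.
have [b ub chib] : exists2 b, b \is a GRing.unit & chi b != 1.
  apply: contra_notP chi1 => H; apply/ffunP => a; rewrite ffunE.
  have [ua|ua] := boolP (a \is a GRing.unit); last by rewrite dirichlet_char0.
  by apply/eqP/negPn/negP => chia; apply: H; exists a.
have [_ chiM _] := Xchi.
set S := \sum_(_ | _) _.
have e : S = chi b * S.
  rewrite /S [LHS](reindex_inj (mulrI ub)) big_distrr /=.
  by apply: eq_big => a; [rewrite unitrM ub|move=> _; rewrite chiM].
move/eqP: e; rewrite -subr_eq0 -{1}[S]mul1r -mulrBl mulf_eq0.
by rewrite subr_eq0 eq_sym (negbTE chib) => /eqP.
Qed.

(* Double counting of the sum of chi(a) over all chi and all units a. *)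
Lemma sum_dirichlet1 : \sum_(chi \in X) (1 : R[i]) = N%:R.
Proof.
transitivity (\sum_(a : 'Z_f | a \is a GRing.unit) \sum_(chi \in X) chi a).
  rewrite (bigD1 (1 : 'Z_f)) ?unitr1//= [X in _ = _ + X]big1; last first.
    by move=> a /andP[ua a1]; exact: sum_dirichlet_neq1.
  by rewrite addr0; apply: eq_fsbigr => chi /set_mem[-> _ _].
under eq_bigr do rewrite (fsbig_finite _ _ finite_dirichlet).
rewrite exchange_big /= -(fsbig_finite _ _ finite_dirichlet).
rewrite (eq_fsbigr (fun chi : char =>
  if chi == [ffun x => (x \is a GRing.unit)%:R] then N%:R else 0)); last first.
  by move=> chi /set_mem Xchi; rewrite sum_units_dirichlet.
rewrite (fsbigD1 [ffun x => (x \is a GRing.unit)%:R])//=; [|exact: finite_dirichlet|exact: dirichlet_principal].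
rewrite eqxx fsbig1 ?addr0// => chi [_ /= /eqP chi1]; by rewrite (negbTE chi1).
Qed.

Lemma sum_dirichlet a : a \is a GRing.unit ->
  \sum_(chi \in X) chi a = (a == 1)%:R * N%:R.
Proof.
move=> ua; have [->|a1] := eqVneq; last by rewrite mul0r sum_dirichlet_neq1.
by rewrite mul1r -sum_dirichlet1; apply: eq_fsbigr => chi /set_mem[-> _ _].
Qed.

Lemma dirichlet_orthogonality m (a b : 'Z_f) :
  a \is a GRing.unit -> b \is a GRing.unit ->
  \sum_(chi \in @characters_of_parity R f m) chi a * (chi b)^*%C =
  N%:R / 2 * ((a == b)%:R + (-1) ^+ m * (a == - b)%:R).
Proof.
move=> ua ub; have ubV : b^-1 \is a GRing.unit by rewrite unitrV.
(* The factor (1 + (-1)^m chi(-1)) / 2 is 1 on the characters of the given parity and 0 on the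
   others, so the sum of [F] extends to all characters. *)
pose F (chi : char) : R[i] := 2^-1 * chi (a / b) + (2^-1 * (-1) ^+ m) * chi (- (a / b)).
transitivity (\sum_(chi \in @characters_of_parity R f m) F chi).
  apply: eq_fsbigr => chi /set_mem[Xchi chiN1]; have [_ chiM' _] := Xchi.
  have chiM x y : chi (x * y) = chi x * chi y := chiM' x y.
  have chiN : chi (- (a / b)) = (-1) ^+ m * chi (a / b).
    by rewrite -(mulN1r (a / b)) (chiM (-1)) chiN1.
  rewrite dirichlet_charV// -chiM /F chiN.
  rewrite mulrA -(mulrA 2^-1) -expr2 sqrr_sign mulr1.
  by field.
rewrite (@fsbig_widen _ _ _ _ _ X); first last.
- move=> chi [Xchi /not_andP[]// chiN1] /=; have [chi1 chiM' _] := Xchi.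
  have chiM x y : chi (x * y) = chi x * chi y := chiM' x y.
  rewrite /F -(mulN1r (a / b)) (chiM (-1)) mulrA -mulrDl.
  have N1u : (-1 : 'Z_f) \is a GRing.unit by rewrite unitrN1.
  have chi2 : chi (-1) = 1 \/ chi (-1) = - 1.
    have : chi (-1) ^+ 2 = 1 by rewrite -dirichlet_charX// sqrrN expr1n chi1.
    by move/eqP; rewrite sqrf_eq1 => /orP[] /eqP; [left|right].
  have sgn2 : ((-1) ^+ m = 1 :> R[i]) \/ ((-1) ^+ m = - 1 :> R[i]).
    by rewrite -signr_odd; case: (odd m); rewrite ?expr1 ?expr0; [right|left].
  move: chiN1; case: chi2 => ->; case: sgn2 => -> chiN1; try by case: chiN1.
    by ring.
  by ring.
- by move=> chi [].
rewrite /F.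
rewrite !fsbig_finite; try exact: finite_dirichlet.
rewrite big_split -!big_distrr -!fsbig_finite /=; try exact: finite_dirichlet.
rewrite !sum_dirichlet; [|by rewrite ?unitrN unitrM ua..].
have -> : (a / b == 1) = (a == b).
  by rewrite -(inj_eq (mulIr ub)) divrK// mul1r.
have -> : (- (a / b) == 1) = (a == - b).
  by rewrite eqr_oppLR -(inj_eq (mulIr ub)) divrK// mulN1r.
ring.
Qed.

End Dirichlet.

(** * Values of L-functions *)

Lemma cvg_regularMl (K : numFieldType) (c : K) (u : nat -> K^o) (l : K^o) :
  u @ \oo --> l -> (fun n => c * u n : K^o) @ \oo --> (c * l : K^o).
Proof. by move=> ul; apply: cvgM; [exact: cvg_cst|]. Qed.

Lemma cvg_dominated0 (K : numFieldType) (V W : normedModType K) (u : nat -> V)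
    (w : nat -> W) : (forall n, `|u n| <= `|w n|) ->
  w @ \oo --> (0 : W) -> u @ \oo --> (0 : V).
Proof.
move=> uw /cvgr0Pnorm_lt w0; apply/cvgr0Pnorm_lt => e e0.
by near=> n; apply: le_lt_trans (uw n) _; near: n; exact: w0.
Unshelve. all: by end_near. Qed.

(* Convergence along full periods, with terms tending to 0, suffices. *)
Lemma cvg_by_blocks (K : numFieldType) (V : normedModType K) (f : nat)
    (G : nat -> V) (l : V) : (0 < f)%N -> G @ \oo --> (0 : V) ->
  (fun M => \sum_(k < M * f) G k) @ \oo --> l ->
  (fun N => \sum_(k < N) G k) @ \oo --> l.
Proof.
move=> f0 G0 Gl.
have qinf A : \oo A -> \oo [set N | A (N %/ f)%N].
  move=> [n _ nA]; exists (n * f)%N => // N /= nN; apply: nA => /=.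
  by rewrite leq_divRL.
(* The remainder after the whole blocks is padded with zeros to a fixed number f of terms, so that
   it tends to 0 term by term. *)
rewrite (_ : (fun N => \sum_(k < N) G k) = fun N =>
   \sum_(k < N %/ f * f) G k + \sum_(r < f) (if (r < N %% f)%N then G (N %/ f * f + r)%N else 0)).
  rewrite -[X in _ --> X]addr0; apply: cvgD.
    move=> A /Gl [n _ nA]; apply: (qinf (fun M => A (\sum_(k < M * f) G k))); exists n => // M /= nM; exact: nA.
  rewrite [X in _ --> X](_ : 0 = \sum_(r < f) (0 : V)); last by rewrite big1_eq.
  apply: cvgn_sum => r _.
  apply: (@cvg_dominated0 _ _ _ _ (fun N => G (N %/ f * f + r)%N)) => [N|].
    by case: ifP => // _; rewrite normr0.
  move=> A /G0 [n _ nA]; exists (n + f)%N => // N /= nN; apply: nA => /=.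
  by have := divn_eq N f; have := ltn_pmod N f0; lia.
apply/funext => N.
transitivity (\sum_(k < N %/ f * f + N %% f) G k); first by rewrite -divn_eq.
rewrite big_split_ord /=; congr (_ + _).
rewrite -big_mkcond /= -(big_mkord (fun r => (r < N %% f)%N) (fun r => G (N %/ f * f + r)%N)).
rewrite -(big_mkord xpredT (fun r => G (N %/ f * f + r)%N)).
by rewrite (big_nat_widen 0 _ f)//= ltnW// ltn_mod.
Qed.

Lemma norm_real_complex (R : realType) (x : R) :
  `|x%:C : R[i]^o| = `|x|%:C :> R[i].
Proof. by rewrite [LHS]normc_def /= expr0n addr0 sqrtr_sqr. Qed.

Lemma cvg_real_complex (R : realType) (u : nat -> R) (l : R) :
  u @ \oo --> l -> (fun n => (u n)%:C : R[i]^o) @ \oo --> (l%:C : R[i]^o).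
Proof.
move=> /cvgrPdist_lt ul; apply/cvgrPdist_lt => e e0.
have eE : e = (complex.Re e)%:C by rewrite RRe_real// gtr0_real.
have Re0 : 0 < complex.Re e by move: e0; rewrite {1}eE ltcR.
near=> n; rewrite -rmorphB eE.
by rewrite norm_real_complex ltcR; near: n; exact: ul.
Unshelve. all: by end_near. Qed.

Section LValue.
Variables (R : realType) (f m : nat) (chi : {ffun 'Z_f -> R[i]}).
Hypotheses (f1 : (1 < f)%N) (m0 : (0 < m)%N).
Hypothesis chiP : @characters_of_parity R f m chi.

Let Xchi : is_dirichlet_character chi. Proof. by case: chiP. Qed.

Let G k : R[i]^o := chi k%:R / k%:R ^+ m.

Let chi_block q a : chi (q * f + a)%:R = chi a%:R.
Proof. by rewrite natrD natrM pchar_Zp// mulr0 add0r. Qed.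

Let chi_reflect a : (a <= f)%N -> chi (f - a)%:R = (-1) ^+ m * chi a%:R.
Proof.
case: chiP => [[_ chiM _] chiN1] af.
have := chiM (-1) a%:R; rewrite /= mulN1r chiN1 => <-.
by rewrite natrB// pchar_Zp// sub0r.
Qed.

Let chi_ncoprime a : ~~ coprime a f -> chi a%:R = 0.
Proof.
by move=> ca; rewrite (dirichlet_char0 Xchi)// unitZpE// coprime_sym.
Qed.

Let norm_chi a : `|chi a| <= 1.
Proof.
have [ua|ua] := boolP (a \is a GRing.unit); last by rewrite (dirichlet_char0 Xchi)// normr0.
have N0 : (0 < totient f)%N by rewrite totient_gt0; lia.
have : `|chi a| ^+ totient f = 1 by rewrite -normrX (dirichlet_char_root f1 Xchi)// normr1.
by move/eqP; rewrite pexpr_eq1// => /eqP ->.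
Qed.

Let G_cvg0 : G @ \oo --> (0 : R[i]^o).
Proof.
apply: (@cvg_dominated0 _ _ _ _ (fun k => (k%:R^-1 : R)%:C : R[i]^o)); last first.
  apply: (@cvg_real_complex R (fun k => k%:R^-1) 0).
  by rewrite -cvg_shiftS; exact: cvg_harmonic.
move=> k; rewrite /G [`|_ / _|]normrM normfV normrX.
have -> : `|(k%:R^-1 : R)%:C : R[i]^o| = k%:R^-1 :> R[i].
  rewrite fmorphV rmorph_nat; exact: (ger0_norm (_ : 0 <= k%:R^-1 :> R[i])).
case: k => [|k]; first by rewrite normr0 expr0n gtn_eqF// invr0 mulr0.
rewrite normr_nat -[leRHS]mul1r ler_pM ?invr_ge0 ?exprn_ge0//.
by rewrite lef_pV2 ?posrE ?exprn_gt0// -[leLHS]expr1 ler_weXn2l// ler1n.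
Qed.

(** Since chi(-1) = (-1)^m, chi(k) / k^m is even in k and the sum is half of a two-sided one. The
    reflection a -> f - a supplies the negative half, and the terms of residue a then form [cotsum]
    at a / f. *)
Let block_sum M : \sum_(k < M * f) G k =
  2^-1 * \sum_(1 <= a < f | coprime a f)
    chi a%:R * ((f%:R ^+ m)^-1 * cotsum m M (a%:R / f%:R : R))%:C.
Proof.
have fR : f%:R != 0 :> R[i] by rewrite pnatr_eq0; lia.
pose H (a : nat) : R[i] := \sum_(s < M) ((s * f + a)%:R ^+ m)^-1.
have e1 : \sum_(k < M * f) G k = \sum_(1 <= a < f | coprime a f) chi a%:R * H a.
  rewrite (sum_blocks f M G) exchange_big /=.
  rewrite -(big_mkord xpredT (fun a => \sum_(s < M) G (s * f + a)%N)).
  rewrite big_ltn; last by lia.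
  have c0 : ~~ coprime 0 f by rewrite /coprime gcd0n; lia.
  rewrite big1 ?add0r => [|s _]; last by rewrite /G chi_block chi_ncoprime// mul0r.
  rewrite [RHS]big_mkcond; apply: eq_bigr => a _.
  case: ifPn => ca.
    by rewrite /H big_distrr; apply: eq_bigr => s _; rewrite /G chi_block.
  by rewrite big1// => s _; rewrite /G chi_block chi_ncoprime// mul0r.
have e2 : \sum_(1 <= a < f | coprime a f) chi a%:R * H a =
   \sum_(1 <= a < f | coprime a f) chi a%:R * ((-1) ^+ m * H (f - a)%N).
  rewrite {1}big_nat_rev /= add1n [LHS]big_nat_cond [RHS]big_nat_cond.
  apply: eq_big => [a|a].
    by case: (boolP (0 < a < f)%N) => //= /andP[a1 af]; rewrite subSS coprime_subl// ltnW.
  move=> /andP[/andP[a1 af] _]; rewrite subSS chi_reflect 1?ltnW//; ring.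
have e3 : \sum_(k < M * f) G k = 2^-1 * (\sum_(1 <= a < f | coprime a f) chi a%:R * H a +
    \sum_(1 <= a < f | coprime a f) chi a%:R * ((-1) ^+ m * H (f - a)%N)).
  by rewrite -e2 -e1; field.
rewrite e3 -big_split /=; congr (_ * _).
rewrite big_nat_cond [RHS]big_nat_cond; apply: eq_bigr => a /andP[/andP[a1 af] _].
rewrite -mulrDr; congr (_ * _).
have fR' : f%:R != 0 :> R by rewrite pnatr_eq0; lia.
have natV b : (b%:R ^+ m)^-1 = ((b%:R ^+ m)^-1 : R)%:C.
  by rewrite fmorphV rmorphXn rmorph_nat.
have sgn : (-1) ^+ m = ((-1) ^+ m : R)%:C by rewrite rmorphXn rmorphN1.
have scale (s b : nat) : ((s * f + b)%:R ^+ m)^-1 =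
    (f%:R ^+ m)^-1 * ((s%:R + b%:R / f%:R) ^+ m)^-1 :> R.
  rewrite -invfM -exprMn mulrDr [f%:R * (b%:R / _)]mulrC divfK//.
  by rewrite natrD natrM mulrC.
rewrite cotsum_fold big_distrr /= /H big_distrr -big_split /= rmorph_sum.
apply: eq_bigr => s _; rewrite !natV sgn -rmorphM -rmorphD; congr (_%:C).
rewrite !scale natrB 1?ltnW// mulrBl divff// mulrDr; congr (_ + _).
by rewrite mulrCA.
Qed.

Lemma dirichlet_L_cotfun : dirichlet_L m chi =
  2^-1 * \sum_(1 <= a < f | coprime a f)
    chi a%:R * ((f%:R ^+ m)^-1 * cotfun m (a%:R / f%:R : R))%:C.
Proof.
have blocks : (fun M => \sum_(k < M * f) G k) @ \oo -->
    (2^-1 * \sum_(1 <= a < f | coprime a f)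
    chi a%:R * ((f%:R ^+ m)^-1 * cotfun m (a%:R / f%:R : R))%:C : R[i]^o).
  rewrite (funext block_sum).
  apply: (@cvg_regularMl _ 2^-1 (fun M => \sum_(1 <= a < f | coprime a f)
    chi a%:R * ((f%:R ^+ m)^-1 * cotsum m M (a%:R / f%:R : R))%:C)).
  rewrite big_nat_cond; under eq_fun do rewrite big_nat_cond.
  apply: (@cvgn_sum _ R[i]^o nat (index_iota 1 f)
      (fun a => (0 < a < f)%N && coprime a f)
      (fun a M => chi a%:R * ((f%:R ^+ m)^-1 * cotsum m M (a%:R / f%:R : R))%:C)
      (fun a => chi a%:R * ((f%:R ^+ m)^-1 * cotfun m (a%:R / f%:R : R))%:C)).
  move=> a /andP[/andP[a1 af] caf].
  apply: (@cvg_regularMl _ (chi a%:R)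
    (fun M => ((f%:R ^+ m)^-1 * cotsum m M (a%:R / f%:R : R))%:C)).
  apply: (@cvg_real_complex R (fun M => (f%:R ^+ m)^-1 * cotsum m M (a%:R / f%:R : R))).
  apply: cvgM; first exact: cvg_cst.
  by apply: cotsum_cvg => //; exact: frac01.
rewrite /dirichlet_L; apply: (@cvg_lim R[i]^o); first exact: norm_hausdorff.
rewrite -cvg_shiftS.
have chi0 : chi 0 = 0.
  by have := @chi_ncoprime 0; rewrite /coprime gcd0n; apply; lia.
have shift N : \sum_(1 <= k < N.+1) chi k%:R / k%:R ^+ m = \sum_(k < N.+1) G k.
  by rewrite -(big_mkord xpredT G) big_ltn// {1}/G chi0 mul0r add0r.
rewrite (funext shift : (fun N => _) = _).
rewrite (cvg_shiftS (fun N => \sum_(k < N) G k)).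
exact: cvg_by_blocks (ltnW f1) G_cvg0 blocks.
Qed.

End LValue.

(** Orthogonality keeps b = a and b = f - a; equal parity of m and n makes the two contributions
    equal, by the reflection of [cotfun n]. The constants are 2 / [totient f] from the mean, 1/4
    from the two L-values and twice [totient f] / 2 from the surviving b, together 1/2. *)
Lemma mean_value_cotfun (R : realType) (m n f : nat) : (1 < f)%N ->
  (0 < m)%N -> (0 < n)%N -> odd m = odd n ->
  mean_value R m n f = (2^-1 * (f%:R ^+ (m + n))^-1 *
    \sum_(1 <= a < f | coprime a f)
       cotfun m (a%:R / f%:R) * cotfun n (a%:R / f%:R))%:C.
Proof.
move=> f1 m0 n0 mn.
pose T j a : R := (f%:R ^+ j)^-1 * cotfun j (a%:R / f%:R).
have same_sign : (-1) ^+ n = (-1) ^+ m :> R[i] by rewrite -signr_odd -mn signr_odd.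
have cfin : finite_set (@characters_of_parity R f m).
  by apply: sub_finite_set (finite_dirichlet R f1) => chi [].
have N0 : (totient f)%:R != 0 :> R[i].
  by rewrite pnatr_eq0 -lt0n totient_gt0; lia.
have unitP a : coprime a f -> (a%:R : 'Z_f) \is a GRing.unit.
  by move=> ca; rewrite unitZpE// coprime_sym.
pose S (a b : nat) : R[i] := (T m a)%:C * (T n b)%:C.
have prodE : \sum_(chi \in @characters_of_parity R f m)
     dirichlet_L m chi * (dirichlet_L n chi)^*%C =
  4^-1 * \sum_(1 <= a < f | coprime a f) \sum_(1 <= b < f | coprime b f)
    S a b * ((totient f)%:R / 2 *
      ((a%:R == b%:R :> 'Z_f)%:R + (-1) ^+ m * (a%:R == - b%:R :> 'Z_f)%:R)).
  transitivity (\sum_(chi \in @characters_of_parity R f m)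
    (4^-1 * \sum_(1 <= a < f | coprime a f) \sum_(1 <= b < f | coprime b f)
    S a b * (chi a%:R * (chi b%:R)^*%C))).
    apply: eq_fsbigr => chi /set_mem chiP.
    have chiPn : @characters_of_parity R f n chi.
      by case: chiP => h1 h2; split => //; rewrite same_sign.
    rewrite (dirichlet_L_cotfun f1 m0 chiP) (dirichlet_L_cotfun f1 n0 chiPn).
    have conj2 : (2^-1 : R[i])^*%C = 2^-1 by rewrite fmorphV rmorph_nat.
    have conjM (x y : R[i]) : (x * y)^*%C = x^*%C * y^*%C := rmorphM _ _ _.
    have conjS (F : nat -> R[i]) : (\sum_(1 <= b < f | coprime b f) F b)^*%C =
      \sum_(1 <= b < f | coprime b f) (F b)^*%C := rmorph_sum _ _ _ _.
    rewrite conjM conjS conj2.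
    rewrite mulrACA; congr (_ * _); first by field.
    rewrite big_distrl; apply: eq_bigr => a _ /=.
    rewrite big_distrr; apply: eq_bigr => b _ /=.
    have conjR (x : R) : (x%:C)^*%C = x%:C by rewrite /= oppr0.
    by rewrite conjM conjR /S /T; ring.
  rewrite -mulr_fsumr; congr (_ * _).
  rewrite fsbig_finite// exchange_big /=; apply: eq_bigr => a ca.
  rewrite exchange_big /=; apply: eq_bigr => b cb.
  rewrite -fsbig_finite// -mulr_fsumr dirichlet_orthogonality ?unitP//.
have aE a b : (a < f)%N -> (b < f)%N -> (a%:R == b%:R :> 'Z_f) = (a == b).
  move=> af bf; rewrite -val_eqE /= !val_Zp_nat// !modn_small//.
have inner a : (0 < a < f)%N && coprime a f ->
  \sum_(1 <= b < f | coprime b f) S a b * ((totient f)%:R / 2 *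
      ((a%:R == b%:R :> 'Z_f)%:R + (-1) ^+ m * (a%:R == - b%:R :> 'Z_f)%:R)) =
  (totient f)%:R * S a a.
  move=> /andP[/andP[a0 af] ca].
  have pick (g : nat -> R[i]) c : (0 < c < f)%N -> coprime c f ->
      \sum_(1 <= b < f | coprime b f) g b * (c == b)%:R = g c.
    move=> cf cc; rewrite (big_rem c) /=; last by rewrite mem_index_iota.
    rewrite cc eqxx mulr1 big_seq_cond big1 ?addr0// => b /andP[+ _].
    by rewrite mem_rem_uniq ?iota_uniq// inE => /andP[bc _]; rewrite eq_sym (negbTE bc) mulr0.
  have reflT : T n (f - a)%N = (-1) ^+ n * T n a.
    rewrite /T natrB 1?ltnW// mulrBl divff ?pnatr_eq0; last by lia.
    by rewrite cotfunN ?frac01//; ring.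
  transitivity (\sum_(1 <= b < f | coprime b f) ((totient f)%:R / 2 * S a b * (a == b)%:R
    + (totient f)%:R / 2 * (-1) ^+ m * S a b * ((f - a)%N == b)%:R)).
    rewrite big_nat_cond [RHS]big_nat_cond; apply: eq_bigr => b /andP[/andP[b0 bf] cb].
    have -> : (a%:R == - b%:R :> 'Z_f) = ((f - a)%N == b).
      have -> : - b%:R = (f - b)%:R :> 'Z_f by rewrite natrB ?pchar_Zp ?sub0r// ltnW.
      by rewrite aE//; lia.
    by rewrite aE//; ring.
  rewrite big_split /= (pick (fun b => (totient f)%:R / 2 * S a b))//; last by rewrite a0.
  rewrite (pick (fun b => (totient f)%:R / 2 * (-1) ^+ m * S a b)); first last.
  - by rewrite coprime_subl// ltnW.
  - lia.
  have signT x : ((-1) ^+ n * x)%:C = (-1) ^+ m * x%:C :> R[i].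
    by rewrite rmorphM rmorphXn rmorphN1 same_sign.
  rewrite /S reflT signT.
  have -> : (totient f)%:R / 2 * (-1) ^+ m * ((T m a)%:C * ((-1) ^+ m * (T n a)%:C)) =
     ((-1) ^+ m) ^+ 2 * ((totient f)%:R / 2 * ((T m a)%:C * (T n a)%:C)) :> R[i] by ring.
  by rewrite sqrr_sign; field.
rewrite /mean_value prodE.
rewrite big_nat_cond (eq_bigr _ inner) -big_nat_cond -big_distrr /=.
have -> : \sum_(1 <= a < f | coprime a f) S a a = ((f%:R ^+ (m + n))^-1 *
    \sum_(1 <= a < f | coprime a f)
       cotfun m (a%:R / f%:R) * cotfun n (a%:R / f%:R))%:C.
  rewrite big_distrr /= rmorph_sum; apply: eq_bigr => a _.
  by rewrite /S -rmorphM /T exprD invfM; congr (_%:C); ring.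
have half x : (2^-1 * x)%:C = 2^-1 * x%:C :> R[i] by rewrite rmorphM fmorphV rmorph_nat.
rewrite -[X in _ = X%:C]mulrA half.
move: (_%:C) => z; field.
by rewrite N0.
Qed.

(** * The mean value *)

(** With i = m - j, both sides are (m + n)! / (j! i! (n - 1)! (n + i)). The left side is the form
    that arises: [pfc] from the partial fractions, the factorials from [zeta_product]. *)
Lemma partial_fraction_coefficient (R : realType) (m n j : nat) :
  (0 < n)%N -> (j <= m)%N ->
  (pfc n (m - j))%:R * ((m + n)`!%:R / (j`!%:R * (m + n - j)`!%:R)) =
  'C(m + n, m)%:R * (n%:R / (m + n - j)%:R * 'C(m, j)%:R) :> R.
Proof.
case: n => // n _ jm; rewrite /pfc.
have -> : (n.+1 + (m - j) = (n + (m - j)).+1)%N by lia.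
have -> : (m + n.+1 - j = (n + (m - j)).+1)%N by lia.
move: (m - j)%N (subnKC jm) => i <- {jm m} /=.
have nz k : k`!%:R != 0 :> R by rewrite pnatr_eq0 -lt0n fact_gt0.
have binR a b : 'C(a + b, a)%:R = (a + b)`!%:R / (a`!%:R * b`!%:R) :> R.
  have := bin_fact (leq_addr b a); rewrite addKn => /(congr1 (fun k => k%:R : R)).
  by rewrite !natrM => <-; rewrite mulfK// mulf_neq0.
have -> : (n + i = i + n)%N by rewrite addnC.
rewrite !binR !factS !natrM.
by field; rewrite !nz -!natrD !nat1r !pnatr_eq0.
Qed.

Section Bernoulli.
Variables (R : realType) (B : nat -> R).
Hypothesis hB : is_bernoulli B.

(** In the Bernoulli quotient the powers of c cancel and the three factors -2 leave one. As c and
    the zeta values are nonzero, so is B (2 r), and the division is a genuine one. *)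
Lemma zeta_product (k r : nat) : (0 < k < r)%N ->
  2 * (zeta R (2 * k) * zeta R (2 * r - 2 * k)) =
  - zeta R (2 * r) * (B (2 * k) * B (2 * r - 2 * k) / B (2 * r) *
    ((2 * r)`!%:R / ((2 * k)`!%:R * (2 * r - 2 * k)`!%:R))).
Proof.
move=> /andP[k0 kr]; have [c c0 bz] := bernoulli_zeta hB.
have nz i : i`!%:R != 0 :> R by rewrite pnatr_eq0 -lt0n fact_gt0.
have {}bz i : (0 < i)%N -> B (2 * i) = - 2 * c ^+ i * zeta R (2 * i) * (2 * i)`!%:R.
  by move=> i0; rewrite -(bz i i0) divfK.
have z0 : zeta R (2 * r) != 0.
  by rewrite gt_eqF// (lt_le_trans ltr01)// zeta_ge1//; lia.
rewrite -mulnBr !bz; [|lia..].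
have -> : c ^+ r = c ^+ k * c ^+ (r - k) by rewrite -exprD subnKC// ltnW.
move: (expf_neq0 k c0) (expf_neq0 (r - k) c0) (nz (2 * k)%N) (nz (2 * r)%N)
  (nz (2 * (r - k))%N) z0.
move: (c ^+ k) (c ^+ (r - k)) (_%:R) (_%:R) (_%:R) (zeta R (2 * r)).
move=> x y u v w z x0 y0 u0 v0 w0 z0; field.
by rewrite x0 y0 u0 v0 w0 z0.
Qed.

Let term (m n f k : nat) : R :=
  n%:R / (m + n - 2 * k)%:R * 'C(m, 2 * k)%:R
  * (B (2 * k)%N * B (m + n - 2 * k)%N / B (m + n)%N)
  * (phi_ R (2 * k) f / f%:R ^+ (m + n - 2 * k)).

Lemma half_mean (m n f : nat) : (1 < f)%N -> (0 < m)%N -> (0 < n)%N -> odd m = odd n ->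
  2^-1 * (f%:R ^+ (m + n))^-1 *
  (\sum_(i < m) (-1) ^+ i * (pfc n i)%:R * (zeta2 R (n + i) *
      \sum_(1 <= a < f | coprime a f) cotfun (m - i) (a%:R / f%:R))) =
  zeta R (m + n) * ((-1) ^+ (m - 1) * 'C(m + n, m)%:R *
    \sum_(1 <= k < m./2.+1) term m n f k).
Proof.
move=> f1 m0 n0 mn.
have fR : f%:R != 0 :> R by rewrite pnatr_eq0; lia.
pose F j : R := (-1) ^+ (m - j) * (pfc n (m - j))%:R *
  (zeta2 R (m + n - j) * (zeta2 R j * (phi_ R j f / f%:R ^+ (m + n - j)))).
transitivity (2^-1 * \sum_(1 <= j < m.+1) F j).
  rewrite -mulrA; congr (_ * _).
  (* Substitute j = m - i: the exponent n + i becomes m + n - j, and the factor f^j of the residue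
     sum cancels against f^(m + n). *)
  rewrite big_add1 big_mkord /= [RHS](reindex_inj rev_ord_inj) big_distrr /=.
  apply: eq_bigr => i _; have im := ltn_ord i.
  have -> : (m - i.+1).+1 = (m - i)%N by lia.
  rewrite sum_coprime_cotfun//; last by lia.
  rewrite /F; have -> : (m - (m - i) = i)%N by lia.
  have -> : (m + n - (m - i) = n + i)%N by lia.
  have -> : f%:R ^+ (m + n) = f%:R ^+ (n + i) * f%:R ^+ (m - i) :> R.
    by rewrite -exprD; congr (_ ^+ _); lia.
  move: (expf_neq0 (n + i) fR) (expf_neq0 (m - i) fR).
  move: (f%:R ^+ (n + i)) (f%:R ^+ (m - i)) => x y x0 y0; field.
  by rewrite x0 y0.
(* Odd j are killed by [zeta2]. As m + n is even, both zeta exponents that remain are even and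
   positive, so [zeta R 1] never occurs. *)
rewrite sum_even_terms => [|j jo]; last by rewrite /F (zeta2_odd _ jo) !(mul0r, mulr0).
rewrite !big_distrr /= big_nat_cond [RHS]big_nat_cond.
apply: eq_bigr => k /andP[/andP[k1 km] _].
have [r rE] : exists r, (m + n = 2 * r)%N by exists (m + n)./2; lia.
have mk : (2 * k <= m)%N by lia.
have -> : term m n f k = (n%:R / (m + n - 2 * k)%:R * 'C(m, 2 * k)%:R)
  * (B (2 * k)%N * B (m + n - 2 * k)%N / B (m + n)%N)
  * (phi_ R (2 * k) f / f%:R ^+ (m + n - 2 * k)) by [].
have coef := partial_fraction_coefficient R n0 mk.
have zz : 2 * (zeta R (2 * k) * zeta R (m + n - 2 * k)) =
  - zeta R (m + n) * (B (2 * k) * B (m + n - 2 * k) / B (m + n) *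
    ((m + n)`!%:R / ((2 * k)`!%:R * (m + n - 2 * k)`!%:R))).
  by rewrite rE; apply: zeta_product; lia.
(* This minus sign cancels the one in [zeta_product]. *)
have sgn : (-1) ^+ (m - 2 * k) = - (-1) ^+ (m - 1) :> R.
  rewrite -signr_odd -[in RHS]signr_odd (_ : odd (m - 2 * k) = ~~ odd (m - 1)); last by lia.
  by case: (odd _); rewrite /= ?expr0 ?expr1 ?opprK.
have z2 : zeta2 R (m + n - 2 * k) = 2 * zeta R (m + n - 2 * k).
  by rewrite rE -mulnBr zeta2_even.
rewrite /F sgn z2 zeta2_even.
transitivity (- (-1) ^+ (m - 1) * (pfc n (m - 2 * k))%:R *
  (phi_ R (2 * k) f / f%:R ^+ (m + n - 2 * k)) *
  (2 * (zeta R (2 * k) * zeta R (m + n - 2 * k)))); first by field; exact: expf_neq0.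
rewrite zz.
transitivity ((-1) ^+ (m - 1) * zeta R (m + n) *
  (phi_ R (2 * k) f / f%:R ^+ (m + n - 2 * k)) *
  (B (2 * k) * B (m + n - 2 * k) / B (m + n)) *
  ((pfc n (m - 2 * k))%:R *
    ((m + n)`!%:R / ((2 * k)`!%:R * (m + n - 2 * k)`!%:R)))).
  by move: (_ / (_ * _)) (phi_ _ _ _ / _) (_ / B _) => x y z; ring.
by rewrite coef; move: (_ / _ * _) (phi_ _ _ _ / _) (_ / B _) => x y z; ring.
Qed.

End Bernoulli.

(** * Final formula and asymptotics in the modulus *)

Lemma phi_ge0_le1 (R : realType) (l f : nat) : 0 <= phi_ R l f <= 1.
Proof.
have fac (p : nat) : p \in primes f -> 0 <= (1 - (p%:R ^+ l)^-1 : R) <= 1.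
  rewrite mem_primes => /andP[/prime_gt0 p0 _].
  have pl : 1 <= p%:R ^+ l :> R by rewrite exprn_ege1// ler1n.
  have pl0 : 0 < p%:R ^+ l :> R by exact: lt_le_trans pl.
  have pl1 : (p%:R ^+ l)^-1 <= 1 :> R by rewrite invf_le1.
  have : 0 < (p%:R ^+ l)^-1 :> R by rewrite invr_gt0.
  by move=> pl2; rewrite subr_ge0 pl1 gerBl ltW.
rewrite /phi_ big_seq; apply/andP; split.
  by apply: prodr_ge0 => p /fac /andP[].
by apply: prodr_ile1 => p /fac.
Qed.

(** The product is the sum of k^-l over k prime to f, which contains k = 1. This bound, uniform in
    f, makes an error tending to 0 negligible relative to the main term, which itself varies with
    f. *)
Lemma zeta_phi_ge1 (R : realType) (l f : nat) : (1 < f)%N -> (1 < l)%N ->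
  1 <= zeta R l * phi_ R l f.
Proof.
move=> f1 l1; have c := @coprime_zeta_cvg R f l f1 l1.
rewrite -(cvg_lim _ c)//; apply: limr_ge; first by apply/cvg_ex; eexists; exact: c.
exists 2%N => // N /= N2.
rewrite (bigD1 (Ordinal N2)) /=; last by rewrite coprime1n.
by rewrite expr1n invr1 lerDl sumr_ge0// => i _; rewrite invr_ge0 exprn_ge0.
Qed.

Lemma phi_div_cvg0 (R : realType) (l p : nat) : (0 < p)%N ->
  (fun f => phi_ R l f / f%:R ^+ p) @ \oo --> (0 : R).
Proof.
move=> p0; apply: (@cvg_dominated0 _ _ _ _ (fun f => f%:R^-1 : R)); last first.
  by rewrite -cvg_shiftS; exact: cvg_harmonic.
move=> f; have /andP[h0 h1] := phi_ge0_le1 R l f.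
rewrite normrM (ger0_norm h0) normfV normrX normr_nat [leRHS]ger0_norm ?invr_ge0//.
case: f h0 h1 => [|f] h0 h1; first by rewrite expr0n gtn_eqF// invr0 mulr0.
rewrite -[leRHS]mul1r ler_pM ?invr_ge0 ?exprn_ge0//.
by rewrite lef_pV2 ?posrE ?exprn_gt0// -[leLHS]expr1 ler_weXn2l// ler1n.
Qed.

Theorem theorem4p2 (R : realType) (B : nat -> R) (hB : is_bernoulli B)
    (m n : nat) (hm : (1 <= m)%N) (hn : (1 <= n)%N) (hmn : odd m = odd n)
    (hmn1 : (m, n) <> (1%N, 1%N)) :
  (forall f : nat, (2 < f)%N ->
     mean_value R m n f =
     (zeta R (m + n) *
      (phi_ R (m + n) f
       + (-1) ^+ (m - 1) * 'C(m + n, m)%:R *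
         \sum_(1 <= k < m./2.+1)
            n%:R / (m + n - 2 * k)%:R * 'C(m, 2 * k)%:R
            * (B (2 * k)%N * B (m + n - 2 * k)%N / B (m + n)%N)
            * (phi_ R (2 * k) f / f%:R ^+ (m + n - 2 * k))
       + (-1) ^+ (n - 1) * 'C(m + n, n)%:R *
         \sum_(1 <= k < n./2.+1)
            m%:R / (m + n - 2 * k)%:R * 'C(n, 2 * k)%:R
            * (B (2 * k)%N * B (m + n - 2 * k)%N / B (m + n)%N)
            * (phi_ R (2 * k) f / f%:R ^+ (m + n - 2 * k))))%:C)
  /\
  (mean_value R m n : nat -> R[i]^o)
    ~_\oo (fun f : nat => (zeta R (m + n) * phi_ R (m + n) f)%:C : R[i]^o).
Proof.
have mn2 : (2 < m + n)%N.
  have [m1|m1] := eqVneq m 1%N; last by lia.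
  have [n1|n1] := eqVneq n 1%N; last by lia.
  by case: hmn1; rewrite m1 n1.
(* The parameter s stands for m + n and is kept apart so that exchanging m and n yields the second
   correction in the required form. *)
pose rest (s m n f : nat) : R := (-1) ^+ (m - 1) * 'C(s, m)%:R *
  \sum_(1 <= k < m./2.+1)
    n%:R / (s - 2 * k)%:R * 'C(m, 2 * k)%:R
      * (B (2 * k)%N * B (s - 2 * k)%N / B s)
      * (phi_ R (2 * k) f / f%:R ^+ (s - 2 * k)).
have meanE f : (2 < f)%N -> mean_value R m n f =
    (zeta R (m + n) * (phi_ R (m + n) f + rest (m + n)%N m n f + rest (m + n)%N n m f))%:C.
  move=> f2; have f1 := ltnW f2.
  rewrite mean_value_cotfun//; congr (_%:C).
  have half1 := half_mean hB f1 hm hn hmn.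
  have half2 := half_mean hB f1 hn hm (esym hmn).
  rewrite (addnC n m) in half2.
  have -> : \sum_(1 <= a < f | coprime a f)
       cotfun m (a%:R / f%:R) * cotfun n (a%:R / f%:R) =
     \sum_(1 <= a < f | coprime a f) cotfun (m + n) (a%:R / f%:R : R) +
     \sum_(i < m) (-1) ^+ i * (pfc n i)%:R * (zeta2 R (n + i) *
        \sum_(1 <= a < f | coprime a f) cotfun (m - i) (a%:R / f%:R)) +
     \sum_(i < n) (-1) ^+ i * (pfc m i)%:R * (zeta2 R (m + i) *
        \sum_(1 <= a < f | coprime a f) cotfun (n - i) (a%:R / f%:R)).
    under [X in _ = _ + X + _]eq_bigr do rewrite !big_distrr /=.
    under [X in _ = _ + X]eq_bigr do rewrite !big_distrr /=.
    rewrite [X in _ = _ + X + _]exchange_big [X in _ = _ + X]exchange_big -!big_split /=.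
    rewrite [LHS]big_nat_cond [RHS]big_nat_cond.
    apply: eq_bigr => a /andP[/andP[a1 af] caf].
    exact: cotfun_mul hm hn mn2 (frac01 R f1 af caf).
  rewrite !mulrDr half1 half2 sum_coprime_cotfun ?addn_gt0 ?hm//.
  congr (_ + _ + _).
  have [r rE] : exists r, (m + n = 2 * r)%N by exists (m + n)./2; lia.
  have fR : f%:R != 0 :> R by rewrite pnatr_eq0; lia.
  rewrite rE zeta2_even; move: (expf_neq0 (2 * r) fR).
  by move: (_ ^+ _) => x x0; field.
split=> [f|]; first exact: meanE.
(* Every power of f in the denominators has positive exponent, since 2 k <= m' < s. *)
have rest_cvg0 s m' n' : (m' < s)%N -> rest s m' n' @ \oo --> (0 : R).
  move=> ms; rewrite -[0](mulr0 ((-1) ^+ (m' - 1) * 'C(s, m')%:R)).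
  apply: cvgM; first exact: cvg_cst.
  rewrite [X in _ --> X](_ : 0 = \sum_(1 <= k < m'./2.+1) (0 : R)); last by rewrite big1_eq.
  rewrite [X in _ --> X]big_nat_cond; under eq_fun do rewrite big_nat_cond.
  apply: cvgn_sum => k /andP[/andP[k1 km] _].
  rewrite -[X in _ --> X](mulr0 (n'%:R / (s - 2 * k)%:R * 'C(m', 2 * k)%:R
      * (B (2 * k)%N * B (s - 2 * k)%N / B s))).
  by apply: cvgM; [exact: cvg_cst|apply: phi_div_cvg0; lia].
have err0 : (fun f => zeta R (m + n) * (rest (m + n)%N m n f + rest (m + n)%N n m f))
    @ \oo --> (0 : R).
  rewrite -[X in _ --> X](mulr0 (zeta R (m + n))) -[X in _ * X](addr0 0).
  apply: cvgM; first exact: cvg_cst.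
  by apply: cvgD; apply: rest_cvg0; lia.
apply/eqaddoP => e e0.
have /cvgr0Pnorm_lt /(_ e e0) := @cvg_real_complex R _ 0 err0.
apply: filter_app; exists 3%N => // f /= f3 errf.
rewrite [X in `|X|](_ : _ = (zeta R (m + n) *
  (rest (m + n)%N m n f + rest (m + n)%N n m f))%:C); last first.
  rewrite !fctE meanE// -rmorphB; congr (_%:C); ring.
apply: le_trans (ltW errf) _.
rewrite -[leLHS]mulr1; apply: ler_wpM2l; first exact: ltW.
have ge1 := @zeta_phi_ge1 R (m + n) f (ltnW f3) (ltnW mn2).
rewrite [leRHS]norm_real_complex ger0_norm; last exact: le_trans ler01 ge1.
by rewrite -[1]/(1%:C) lecR.
Qed.
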